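(* Let $r$ be an integer at least $3$. Then $N^*_{1/3}(r)$ equals $10$ if $r=5$, $16$ if $r=6$, $28$ if $r=7$, and $2(r-1)$ otherwise. More precisely, an arbitrary set of equiangular lines with common angle $\arccos(1/3)$ of rank $r$ and cardinality $N^*_{1/3}(r)$ is induced by the Seidel matrix of a graph switching equivalent to $L(K_5)$ if $r=5$, $L(K_6)+K_1$ if $r=6$, $L(K_8)$ if $r=7$, and $L(K_{2,r-1})$ otherwise.
   Context: A set of lines (through the origin) in a Euclidean space is equiangular if any pair of distinct lines forms the same angle. The rank of a set of equiangular lines is the smallest dimension of Euclidean spaces into which these lines are isometrically embedded (i.e. the dimension of their linear span). $N^*_{\alpha}(r)$ denotes the maximum cardinality of a set of equiangular lines with common angle $\arccos(\alpha)$ of rank $r$. All graphs are finite, simple, undirected, without loops. The Seidel matrix of a graph $G$ is $S(G)=\mathbf{J}-\mathbf{I}-2A(G)$, where $A(G)$ is the adjacency matrix, $\mathbf{J}$ the all-ones matrix and $\mathbf{I}$ the identity matrix. If $S$ is a Seidel matrix with largest eigenvalue $\lambda$, there exist vectors whose Gram matrix equals $\lambda\mathbf{I}-S$; the lines spanned by these vectors are equiangular with common angle $\arccos(1/\lambda)$ and rank $\operatorname{rank}(\lambda\mathbf{I}-S)$, and this set of lines is said to be induced by $S$ (here with $\lambda=3$). For a graph $G=(V,E)$ and $U\subseteq V$, the graph $G^U$ obtained by switching with respect to $U$ has vertex set $V$ and is obtained from $G$ by keeping adjacency between pairs inside $U$ and pairs inside $V\setminus U$, and reversing adjacency between each vertex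 of $U$ and each vertex of $V\setminus U$. Two graphs are switching equivalent if one is isomorphic to a graph obtained from the other by switching. $L(\cdot)$ denotes the line graph, $K_a$ the complete graph, $K_{a,b}$ the complete bipartite graph, and $G+H$ the disjoint union of graphs $G$ and $H$. *)

(* Defs.v *)
From HB Require Import structures.
From mathcomp Require Import all_boot all_order all_algebra.
From mathcomp Require Import all_classical all_reals all_analysis.

Set Implicit Arguments.
Unset Strict Implicit.
Unset Printing Implicit Defensive.

Import Order.TTheory GRing.Theory Num.Theory.
Local Open Scope classical_set_scope.
Local Open Scope card_scope.
Local Open Scope ring_scope.

(** * Finite simple graphs *)

Record sgraph := SGraph {
  vert :> finType;
  adj : rel vert;
  adj_sym : symmetric adj;
  adj_irr : irreflexive adj }.

Arguments adj {s} x y.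

Definition isomorphic (G H : sgraph) : Prop :=
  exists f : G -> H, bijective f /\ forall x y : G, adj (f x) (f y) = adj x y.

Section Switching.
Variables (G : sgraph) (U : {set G}).

Definition switch_rel : rel G := fun x y =>
  if (x \in U) == (y \in U) then adj x y else ~~ adj x y.

Lemma switch_sym : symmetric switch_rel.
Proof. by move=> x y; rewrite /switch_rel eq_sym (adj_sym x y). Qed.

Lemma switch_irr : irreflexive switch_rel.
Proof. by move=> x; rewrite /switch_rel eqxx adj_irr. Qed.

Definition switch : sgraph := SGraph switch_sym switch_irr.
End Switching.

Definition switching_equivalent (G H : sgraph) : Prop :=
  exists U : {set H}, isomorphic G (switch U).

Section Complete.
Variable a : nat.

Definition complete_rel : rel 'I_a := fun x y => x != y.

Lemma complete_sym : symmetric complete_rel.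
Proof. by move=> x y; rewrite /complete_rel eq_sym. Qed.

Lemma complete_irr : irreflexive complete_rel.
Proof. by move=> x; rewrite /complete_rel eqxx. Qed.

Definition complete : sgraph := SGraph complete_sym complete_irr.
End Complete.

Section CompleteBipartite.
Variables a b : nat.

Definition complete_bip_rel : rel ('I_a + 'I_b)%type := fun x y =>
  match x, y with
  | inl _, inr _ | inr _, inl _ => true
  | _, _ => false
  end.

Lemma complete_bip_sym : symmetric complete_bip_rel.
Proof. by case=> x [] y. Qed.

Lemma complete_bip_irr : irreflexive complete_bip_rel.
Proof. by case. Qed.

Definition complete_bip : sgraph := SGraph complete_bip_sym complete_bip_irr.
End CompleteBipartite.

Section DisjointUnion.
Variables G H : sgraph.

Definition dunion_rel : rel (G + H)%type := fun x y =>
  match x, y with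
  | inl x, inl y => adj x y
  | inr x, inr y => adj x y
  | _, _ => false
  end.

Lemma dunion_sym : symmetric dunion_rel.
Proof. by case=> x [] y //=; rewrite adj_sym. Qed.

Lemma dunion_irr : irreflexive dunion_rel.
Proof. by case=> x /=; rewrite adj_irr. Qed.

Definition dunion : sgraph := SGraph dunion_sym dunion_irr.
End DisjointUnion.

Definition edges (G : sgraph) : {set {set G}} :=
  [set e : {set G} | [exists x, exists y, adj x y && (e == [set x; y]%SET)]].

Section LineGraph.
Variable G : sgraph.

Definition edge : finType := {e : {set G} | e \in edges G}.

Definition line_graph_rel : rel edge := fun e f =>
  (e != f) && (val e :&: val f != finset.set0).

Lemma line_graph_sym : symmetric line_graph_rel.
Proof. by move=> e f; rewrite /line_graph_rel eq_sym finset.setIC. Qed.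

Lemma line_graph_irr : irreflexive line_graph_rel.
Proof. by move=> e; rewrite /line_graph_rel eqxx. Qed.

Definition line_graph : sgraph := SGraph line_graph_sym line_graph_irr.
End LineGraph.

(** * Seidel matrices; rows and columns follow the enumeration of the vertices *)

Definition adjacency (R : realType) (G : sgraph) : 'M[R]_#|G| :=
  \matrix_(i, j) (adj (enum_val i : G) (enum_val j))%:R.

Definition seidel (R : realType) (G : sgraph) : 'M[R]_#|G| :=
  const_mx 1 - 1%:M - 2 *: adjacency R G.

Definition largest_eigenvalue (R : realType) n (S : 'M[R]_n) (lambda : R) :
    Prop :=
  eigenvalue S lambda /\ forall mu : R, eigenvalue S mu -> mu <= lambda.

(** * Equiangular lines in the Euclidean spaces ['rV[R]_d] *)

Section Lines.
Variables (R : realType) (d : nat).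
Implicit Types (u v : 'rV[R]_d) (L M W : {vspace 'rV[R]_d})
  (X : set {vspace 'rV[R]_d}).

(* The library norm on ['rV[R]_d] is the sup norm, hence [enorm]. *)
Definition dot u v : R := \sum_(k < d) u 0 k * v 0 k.
Definition enorm u : R := Num.sqrt (dot u u).

Definition is_line L : Prop := \dim L = 1%N.

(* [line_angle_eq] below: the chosen spanning vectors do not matter. *)
Definition line_angle L M : R :=
  acos (`|dot (vpick L) (vpick M)| / (enorm (vpick L) * enorm (vpick M))).

Definition equiangular X (alpha : R) : Prop :=
  (forall L, X L -> is_line L) /\
  (forall L M, X L -> X M -> L <> M -> line_angle L M = acos alpha).

Definition is_span X W : Prop :=
  (forall L, X L -> (L <= W)%VS) /\
  (forall W', (forall L, X L -> (L <= W')%VS) -> (W <= W')%VS).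

Definition lines_rank X (r : nat) : Prop := exists W, is_span X W /\ \dim W = r.

Definition gram n (v : 'I_n -> 'rV[R]_d) : 'M[R]_n :=
  \matrix_(i, j) dot (v i) (v j).

Definition induced_by n (S : 'M[R]_n) (lambda : R) X : Prop :=
  largest_eigenvalue S lambda /\
  exists v : 'I_n -> 'rV[R]_d,
    gram v = lambda%:M - S /\ X = range (fun i => <[v i]>%VS).

Lemma dotZ (a b : R) u v : dot (a *: u) (b *: v) = a * b * dot u v.
Proof.
rewrite /dot mulr_sumr; apply: eq_bigr => k _.
by rewrite !mxE mulrACA.
Qed.

Lemma enormZ (a : R) u : enorm (a *: u) = `|a| * enorm u.
Proof. by rewrite /enorm dotZ -expr2 sqrtrM ?sqr_ge0// sqrtr_sqr. Qed.

Lemma line_vpick L u : is_line L -> u \in L -> u != 0 ->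
  exists2 a : R, a != 0 & vpick L = a *: u.
Proof.
move=> dimL uL u0.
have LE : L = <[u]>%VS.
  apply/esym/eqP; rewrite eqEdim -memvE uL dim_vline u0.
  by rewrite dimL.
have /vlineP[a aE] : vpick L \in <[u]>%VS by rewrite -LE memv_pick.
exists a => //; apply/eqP => a0; move: aE; rewrite a0 scale0r => /eqP.
by rewrite vpick0 => /eqP L0; move: dimL; rewrite /is_line L0 dimv0.
Qed.

Lemma line_angle_eq L M u v : is_line L -> is_line M ->
  u \in L -> u != 0 -> v \in M -> v != 0 ->
  line_angle L M = acos (`|dot u v| / (enorm u * enorm v)).
Proof.
move=> dL dM uL u0 vM v0; rewrite /line_angle.
have [a a0 ->] := line_vpick dL uL u0.
have [b b0 ->] := line_vpick dM vM v0.
congr acos; rewrite dotZ !enormZ mulrACA !normrM -mulf_div divff ?mul1r//.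
by rewrite mulf_neq0// normr_eq0.
Qed.

End Lines.

(* [is_Nstar R alpha r n]: n is N^*_alpha(r).  The sets in the supremum are
   not assumed finite and may live in a Euclidean space of any dimension. *)
Definition is_Nstar (R : realType) (alpha : R) (r n : nat) : Prop :=
  (exists d (X : set {vspace 'rV[R]_d}),
     [/\ equiangular X alpha, lines_rank X r & X #= `I_n]) /\
  (forall d (X : set {vspace 'rV[R]_d}),
     equiangular X alpha -> lines_rank X r -> X #<= `I_n).

(* Main.v *)
Require Import Defs.
From mathcomp Require Import all_boot all_order all_algebra.
From mathcomp Require Import all_classical all_reals all_analysis.
From mathcomp Require Import ring lra zify.
From mathcomp Require finmap.

(** On each line choose a vector of norm 3; different vectors then have product 1
    or -1, and changing signs does not change the lines. Two cases arise.

    If the signs can be chosen so that any two vectors have product 1, their Gram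
    matrix is [2 I + J], the vectors are independent, and there are only as many
    lines as the rank ([no_triangle_free]).

    Otherwise three vectors have pairwise products -1 for suitable signs. Their
    negated sum spans a line that may be added without changing the rank
    ([triangle_fourth]), so in a maximal set it is already there. The four
    vectors [p] of sum zero are signed sums of an orthonormal frame [h] of their
    span, and every other line is spanned by [h k + x], for one of the three [k]
    and a vector [x] of norm 2 orthogonal to the frame ([decomposition_exists]).
    These roots [x] form three pillars: within a pillar they are orthogonal or
    opposite, and roots of different pillars have product 1 or -1. Let [m] be
    the dimension of the span of the roots, so that the rank is [m + 3].

    If a single pillar is inhabited, it has at most [2 m] roots, and there are at
    most [2 m + 4 = 2 (r - 1)] lines; in the case of equality they come from the
    frame [h k] and orthogonal vectors [q i] of norm 2, as the edges of K_{2,r-1}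
    come from its vertices ([single_pillar_frame]).

    If two pillars are inhabited, projecting away from orthogonal roots of one of
    them leaves residuals that are forced to be parallel or orthogonal, and one
    finds [m <= 4] ([several_pillars_dim]). By Bessel's inequality a pillar has at
    most four pairs of opposite roots, and at most [m - 1] pairs unless [m = 4]
    ([pillar_size]). So there are at most 4 + 6, 4 + 12 or 4 + 24 lines for
    [m = 2, 3, 4], which beats [2 (r - 1)]. In the case of equality the roots are
    those of A_2, A_3 or D_4, and in coordinates adapted to them one writes down
    vectors [f i] with Gram matrix [2 I - J / 4] such that the lines are spanned
    by the sums [f i + f j], together with the sum of all six [f i] if [m = 3]
    ([simplex5_of_pillars], [simplex6_of_pillars], [simplex8_of_pillars]). Two of
    these sums have product 1 when they share an index and -1 otherwise, as in the
    line graph of a complete graph; up to sign, the sum of all six [f i] is the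
    isolated vertex.

    The same models, realized by a regular simplex and by an orthogonal basis,
    show that the bounds are attained ([extremal_graph_frame_exists]). *)

Set Implicit Arguments.
Unset Strict Implicit.
Unset Printing Implicit Defensive.

Import Order.TTheory GRing.Theory Num.Theory.
Local Open Scope classical_set_scope.
Local Open Scope card_scope.
Local Open Scope ring_scope.

(** * Euclidean inner products *)

Section Dot.
Context {R : realType} {d : nat}.
Implicit Types (u v w : 'rV[R]_d) (s : seq 'rV[R]_d).

Lemma dotC u v : dot u v = dot v u.
Proof. by apply: eq_bigr => k _; rewrite mulrC. Qed.

Lemma dotDl u v w : dot (u + v) w = dot u w + dot v w.
Proof. by rewrite /dot -big_split; apply: eq_bigr => k _; rewrite mxE mulrDl. Qed.

Lemma dotZl (a : R) u w : dot (a *: u) w = a * dot u w.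
Proof. by rewrite /dot mulr_sumr; apply: eq_bigr => k _; rewrite mxE mulrA. Qed.

Lemma dotDr u v w : dot w (u + v) = dot w u + dot w v.
Proof. by rewrite dotC dotDl !(dotC w). Qed.

Lemma dotZr (a : R) u w : dot w (a *: u) = a * dot w u.
Proof. by rewrite dotC dotZl (dotC w). Qed.

Lemma dot0l u : dot 0 u = 0.
Proof. by rewrite -(scale0r 0) dotZl mul0r. Qed.

Lemma dot0r u : dot u 0 = 0.
Proof. by rewrite dotC dot0l. Qed.

Lemma dotNl u w : dot (- u) w = - dot u w.
Proof. by rewrite -scaleN1r dotZl mulN1r. Qed.

Lemma dotNr u w : dot w (- u) = - dot w u.
Proof. by rewrite dotC dotNl dotC. Qed.

Lemma dot_suml (I : Type) (r : seq I) (P : pred I) (F : I -> 'rV[R]_d) w :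
  dot (\sum_(i <- r | P i) F i) w = \sum_(i <- r | P i) dot (F i) w.
Proof.
by elim/big_rec2: _ => [|i x y _ <-]; rewrite ?dot0l// dotDl.
Qed.

Lemma dot_sumr (I : Type) (r : seq I) (P : pred I) (F : I -> 'rV[R]_d) w :
  dot w (\sum_(i <- r | P i) F i) = \sum_(i <- r | P i) dot w (F i).
Proof. by rewrite dotC dot_suml; apply: eq_bigr => i _; rewrite dotC. Qed.

Definition dotE := (dotDl, dotDr, dotNl, dotNr, dotZl, dotZr, dot0l, dot0r).

Lemma dot_ge0 u : 0 <= dot u u.
Proof. by apply: sumr_ge0 => k _; rewrite -expr2 sqr_ge0. Qed.

Lemma dot_eq0 u : dot u u = 0 -> u = 0.
Proof.
move/eqP; rewrite /dot psumr_eq0; last by move=> k _; rewrite -expr2 sqr_ge0.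
move/allP => h; apply/rowP => k; rewrite mxE; apply/eqP.
by have := h k (mem_index_enum k); rewrite mulf_eq0 orbb.
Qed.

Lemma dot_CS u v : dot u v ^+ 2 <= dot u u * dot v v.
Proof.
have [v0|v0] := eqVneq (dot v v) 0.
  by rewrite (dot_eq0 v0) !dot0r mulr0 expr0n.
have vgt0 : 0 < dot v v by rewrite lt_neqAle eq_sym v0 dot_ge0.
have := dot_ge0 (dot v v *: u - dot u v *: v).
rewrite !dotE (dotC v u) => h.
have {}h : 0 <= dot v v * (dot u u * dot v v - dot u v ^+ 2) by lra.
by rewrite pmulr_rge0// subr_ge0 in h.
Qed.

(** The equality case of the Cauchy-Schwarz inequality: [u - v] has norm zero. *)
Lemma dot_eq_same (c : R) u v :
  dot u u = c -> dot v v = c -> dot u v = c -> u = v.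
Proof.
move=> uu vv uv; apply/eqP; rewrite -subr_eq0; apply/eqP/dot_eq0.
by rewrite !dotE (dotC v u) uu vv uv; lra.
Qed.

Lemma dot_eq_opp (c : R) u v :
  dot u u = c -> dot v v = c -> dot u v = - c -> u = - v.
Proof.
move=> uu vv uv; apply: (@dot_eq_same c) => //.
  by rewrite !dotE opprK.
by rewrite dotNr uv opprK.
Qed.

Lemma dot_bounded (c : R) u v : 0 <= c -> dot u u = c -> dot v v = c ->
  - c <= dot u v <= c.
Proof.
move=> c0 uu vv; have := dot_CS u v; rewrite uu vv -expr2.
by rewrite -ler_norml -[_ <= c]ler_sqr ?nnegrE// real_normK// num_real.
Qed.

Lemma orth_span s w v : (forall u, u \in s -> dot u w = 0) -> v \in span s ->
  dot v w = 0.
Proof.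
move=> sw /(@coord_span _ _ _ (in_tuple s)) ->.
rewrite dot_suml big1// => i _.
by rewrite dotZl sw ?mulr0// mem_nth.
Qed.

(** Up to a diagonal scaling the Gram matrix is [a I + c J], with eigenvalues [a]
    and [a + n c], so it is invertible. *)
Lemma free_gram s (e : 'rV[R]_d -> R) (a c : R) :
  uniq s -> a != 0 -> a + (size s)%:R * c != 0 ->
  {in s, forall u, e u != 0} ->
  {in s &, forall u v, dot u v = e u * e v * (c + a * (u == v)%:R)} ->
  free s.
Proof.
move=> us a0 ac0 e0 es; apply/(@freeP _ _ _ (in_tuple s)) => k /= ks.
pose E i := e s`_i; pose T := \sum_(i < size s) k i * E i.
have kE i : a * (k i * E i) = - (c * T).
  have si : s`_i \in s by rewrite mem_nth.
  have : dot (\sum_(j < size s) k j *: s`_j) s`_i = 0 by rewrite ks dot0l.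
  rewrite dot_suml (eq_bigr (fun j => E i * c * (k j * E j) +
            E i * a * (k j * E j * (j == i)%:R))); last first.
    move=> j _; rewrite dotZl es ?mem_nth// nth_uniq// /E -val_eqE; ring.
  rewrite big_split -!mulr_sumr /= -/T (bigD1 i)//= eqxx big1 ?addr0; last first.
    by move=> j /negPf ->; rewrite mulr0.
  move=> h; have {}h : E i * (c * T + a * (k i * E i)) = 0 by rewrite -h /=; ring.
  move/eqP: h; rewrite mulf_eq0 (negPf (e0 _ si))/= addr_eq0 => /eqP ->.
  by rewrite opprK.
have T0 : T = 0.
  have : \sum_(i < size s) a * (k i * E i) = \sum_(i < size s) - (c * T).
    by apply: eq_bigr => i _; exact: kE.
  rewrite -mulr_sumr -/T sumr_const card_ord -mulr_natl => h.
  have {}h : (a + (size s)%:R * c) * T = 0 by lra.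
  by move/eqP: h; rewrite mulf_eq0 (negPf ac0) => /eqP.
move=> i; have si : s`_i \in s by rewrite mem_nth.
have /eqP := kE i; rewrite T0 mulr0 oppr0 !mulf_eq0 (negPf a0)/=.
by rewrite (negPf (e0 _ si)) orbF => /eqP.
Qed.

End Dot.

(** * Systems of vectors of norm 3 with products 1 and -1 *)

Section Systems.
Context {R : realType} {d : nat}.
Implicit Types (u v w y z p : 'rV[R]_d) (s t : seq 'rV[R]_d).

Definition is_sign (a : R) : Prop := a = 1 \/ a = -1.

(** A line contains two opposite vectors of norm 3, so a statement about lines
    becomes one about vectors up to sign. *)
Definition mem_pm s y : bool := (y \in s) || (- y \in s).

(** One vector of norm 3 on each line of a set with angle arccos (1/3). *)
Record sign_system s : Prop := SignSystem {
  sign_system_uniq : uniq s;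
  sign_system_norm : {in s, forall u, dot u u = 3};
  sign_system_dot : {in s &, forall u v, u != v -> is_sign (dot u v)} }.

Lemma mem_pmN s y : mem_pm s (- y) = mem_pm s y.
Proof. by rewrite /mem_pm opprK orbC. Qed.

Lemma mem_pmW s y : y \in s -> mem_pm s y.
Proof. by rewrite /mem_pm => ->. Qed.

Lemma mem_pm_sign s a y : is_sign a -> mem_pm s y -> mem_pm s (a *: y).
Proof. by case=> ->; rewrite ?scale1r// scaleN1r mem_pmN. Qed.

Lemma mem_pm_span s y : mem_pm s y -> y \in span s.
Proof. by case/orP => /memv_span //; rewrite memvN. Qed.

Lemma mem_pm_norm s y : sign_system s -> mem_pm s y -> dot y y = 3.
Proof.
by move=> [_ n _] /orP[/n//|/n]; rewrite dotNl dotNr opprK.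
Qed.

Lemma mem_pm_dot s y z : sign_system s -> mem_pm s y -> mem_pm s z ->
  [\/ y = z, y = - z | is_sign (dot y z)].
Proof.
move=> [_ _ n] /orP[] ys /orP[] zs.
- have [->|/(n _ _ ys zs)] := eqVneq y z; first by constructor.
  by constructor 3.
- have [->|/(n _ _ ys zs)] := eqVneq y (- z); first by constructor.
  rewrite dotNr => h; constructor 3; case: h => h; [right|left]; lra.
- have [<-|/(n _ _ ys zs)] := eqVneq (- y) z.
    by rewrite opprK; constructor 2.
  rewrite dotNl => h; constructor 3; case: h => h; [right|left]; lra.
- have [/oppr_inj ->|/(n _ _ ys zs)] := eqVneq (- y) (- z).
    by constructor.
  by rewrite dotNl dotNr opprK; constructor 3.
Qed.

Lemma sign_system_neq_opp s y z : sign_system s -> y \in s -> z \in s -> y != - z.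
Proof.
move=> es ys zs; apply/eqP => yz.
have zz : dot z z = 3 by rewrite (sign_system_norm es).
have yzn : dot y z = -3 by rewrite yz dotNl zz.
have [e|ne] := eqVneq y z; first by move: yzn; rewrite e zz; lra.
by case: (sign_system_dot es ys zs ne); rewrite yzn; lra.
Qed.

Section Resign.
Variables (s : seq 'rV[R]_d) (e : 'rV[R]_d -> R).
Hypotheses (es : sign_system s) (e_sign : {in s, forall y, is_sign (e y)}).

Let s1 := [seq e y *: y | y <- s].

(** Other signs give other representatives of the same lines. *)
Lemma resign_sign_system : sign_system s1.
Proof.
have gi : {in s &, injective (fun y => e y *: y)}.
  move=> y z ys zs; case: (e_sign ys) => ->; case: (e_sign zs) => ->;
    rewrite ?scale1r ?scaleN1r //.
  - by move=> h; have := sign_system_neq_opp es ys zs; rewrite h eqxx.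
  - by move=> h; have := sign_system_neq_opp es zs ys; rewrite -h eqxx.
  - exact: oppr_inj.
split.
- by rewrite map_inj_in_uniq ?(sign_system_uniq es).
- move=> _ /mapP[y ys ->]; rewrite dotZl dotZr (sign_system_norm es)//.
  by case: (e_sign ys) => ->; lra.
- move=> _ _ /mapP[y ys ->] /mapP[z zs ->] ne.
  have {}ne : y != z by apply: contra_neq ne => ->.
  have := sign_system_dot es ys zs ne; rewrite dotZl dotZr /is_sign.
  by case: (e_sign ys) => ->; case: (e_sign zs) => -> [] ->; lra.
Qed.

Lemma resign_mem y : mem_pm s1 y = mem_pm s y.
Proof.
apply/idP/idP.
  have h z : z \in s1 -> mem_pm s z.
    by case/mapP => x xs ->; apply: mem_pm_sign (e_sign xs) (mem_pmW xs).
  by case/orP => /h //; rewrite mem_pmN.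
have h z : z \in s -> mem_pm s1 z.
  move=> zs; rewrite (_ : z = e z *: (e z *: z)).
    exact: mem_pm_sign (e_sign zs) (mem_pmW (map_f _ zs)).
  by case: (e_sign zs) => ->; rewrite ?scale1r // !scaleN1r opprK.
by case/orP => /h //; rewrite mem_pmN.
Qed.

Lemma resign_span : span s1 = span s.
Proof.
apply/eqP; rewrite eqEsubv; apply/andP; split; apply/span_subvP => y ys.
  by apply: mem_pm_span; rewrite -resign_mem mem_pmW.
by apply: mem_pm_span; rewrite resign_mem mem_pmW.
Qed.

End Resign.

(** Three lines whose vectors cannot all be given positive products. *)
Definition triangle s p1 p2 p3 : Prop :=
  [/\ mem_pm s p1, mem_pm s p2 & mem_pm s p3] /\
  [/\ dot p1 p2 = -1, dot p1 p3 = -1 & dot p2 p3 = -1].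

(** Multiply each other vector by its product with [u0]. In the absence of
    triangles all products become 1, and the Gram matrix becomes [2 I + J]. *)
Lemma no_triangle_free s : sign_system s -> ~ (exists p1 p2 p3, triangle s p1 p2 p3) ->
  free s.
Proof.
case: s => [|u0 s] es nt; first by rewrite nil_free.
set t := u0 :: s in es nt *.
have u0t : u0 \in t by rewrite mem_head.
pose e u := if u == u0 then 1 else dot u u0.
have esg u : u \in t -> is_sign (e u).
  rewrite /e => ut; case: eqVneq => [_|ne]; first by left.
  exact: (sign_system_dot es).
have enz u : u \in t -> e u != 0.
  by move=> /esg[] ->; rewrite ?oppr_eq0 oner_eq0.
apply: (@free_gram _ _ _ e 2 1) => //; first exact: sign_system_uniq es.
move=> u v ut vt; have [<-|ne] := eqVneq u v.
  by rewrite (sign_system_norm es)//=; case: (esg u ut) => ->; lra.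
rewrite mulr0 addr0 mulr1.
case: (eqVneq u u0) => [uu0|nu].
  rewrite /e uu0 eqxx mul1r; case: (eqVneq v u0) => [vu0|_].
    by rewrite uu0 vu0 eqxx in ne.
  exact: dotC.
case: (eqVneq v u0) => [vu0|nv].
  by rewrite /e vu0 eqxx (negPf nu) mulr1.
have eu : e u = dot u u0 by rewrite /e (negPf nu).
have ev : e v = dot v u0 by rewrite /e (negPf nv).
apply/eqP; apply: contra_notT nt => ne1.
(* With these signs [u0] has product -1 with the two others. *)
exists (- u0), (e u *: u), (e v *: v); split.
  split; first by rewrite mem_pmN mem_pmW.
    exact: mem_pm_sign (esg u ut) (mem_pmW ut).
  exact: mem_pm_sign (esg v vt) (mem_pmW vt).
rewrite !dotE !(dotC u0) -eu -ev; move: ne1.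
have := sign_system_dot es ut vt ne.
case: (esg u ut) => ->; case: (esg v vt) => ->; case=> ->;
  rewrite ?mulr1 ?mulrN1 ?opprK ?eqxx // => _; split; lra.
Qed.

(** The product of [p4] with another vector is an odd integer. Were it 3 or -3,
    the Cauchy-Schwarz inequality would make the two vectors parallel. *)
Lemma triangle_fourth s p1 p2 p3 : sign_system s -> triangle s p1 p2 p3 ->
  let p4 := - (p1 + p2 + p3) in ~~ mem_pm s p4 ->
  sign_system (p4 :: s) /\ span (p4 :: s) = span s.
Proof.
move=> es [[m1 m2 m3] [d12 d13 d23]] p4 np4.
have n1 := mem_pm_norm es m1; have n2 := mem_pm_norm es m2.
have n3 := mem_pm_norm es m3.
have n4 : dot p4 p4 = 3.
  by rewrite /p4 !dotE (dotC p2 p1) (dotC p3 p1) (dotC p3 p2) n1 n2 n3 d12 d13 d23; lra.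
have p4s : {in s, forall y, is_sign (dot p4 y)}.
  move=> y ys; have ym := mem_pmW ys; have ny := mem_pm_norm es ym.
  have np : y <> p4 by move=> e; rewrite -e ym in np4.
  have np' : y <> - p4 by move=> e; rewrite -mem_pmN -e ym in np4.
  have d4 : dot p4 y = - (dot p1 y + dot p2 y + dot p3 y).
    by rewrite /p4 !dotE.
  have a1 := mem_pm_dot es m1 ym; have a2 := mem_pm_dot es m2 ym.
  have a3 := mem_pm_dot es m3 ym.
  have H (p q r : 'rV[R]_d) : p4 = - (p + q + r) -> dot p q = -1 ->
      dot p r = -1 -> dot p p = 3 -> p = y \/ p = - y -> is_sign (dot p4 y).
    move=> -> pq pr pp [<-|/eqP].
      by right; rewrite !dotE ?(dotC q) ?(dotC r) pq pr pp; lra.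
    rewrite eq_sym eqr_oppLR => /eqP ->.
    by left; rewrite !dotE ?(dotC q) ?(dotC r) pq pr pp; lra.
  case: a1 => [e|e|a1].
  - by apply: (H p1 p2 p3) => //; left.
  - by apply: (H p1 p2 p3) => //; right.
  case: a2 => [e|e|a2].
  - by apply: (H p2 p1 p3) => //; [rewrite /p4 (addrC p1)|rewrite dotC|left].
  - by apply: (H p2 p1 p3) => //; [rewrite /p4 (addrC p1)|rewrite dotC|right].
  case: a3 => [e|e|a3].
  - by apply: (H p3 p1 p2) => //;
      [rewrite /p4 [_ + p3]addrC addrA|rewrite dotC|rewrite dotC|left].
  - by apply: (H p3 p1 p2) => //;
      [rewrite /p4 [_ + p3]addrC addrA|rewrite dotC|rewrite dotC|right].
  have d3 : dot p4 y != 3.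
    by apply: contra_notN np => /eqP h; apply/esym/(dot_eq_same n4 ny h).
  have d3' : dot p4 y != -3.
    apply: contra_notN np' => /eqP h; apply: (dot_eq_opp ny n4).
    by rewrite dotC.
  move: d3 d3'; rewrite d4 /is_sign.
  case: a1 => ->; case: a2 => ->; case: a3 => -> /eqP h /eqP h'; lra.
split; last first.
  rewrite span_cons; apply/addv_idPr; rewrite -memvE /p4 memvN.
  by rewrite !memvD// mem_pm_span.
split.
- by rewrite cons_uniq (sign_system_uniq es) andbT; apply: contraNN np4 => /mem_pmW.
- by move=> u; rewrite inE => /orP[/eqP -> //|]; exact: (sign_system_norm es).
- move=> u v; rewrite !inE => /orP[/eqP ->|us] /orP[/eqP ->|vs].
  + by rewrite eqxx.
  + by move=> _; exact: p4s.
  + by move=> _; rewrite dotC; exact: p4s.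
  + exact: (sign_system_dot es).
Qed.

End Systems.

(** * The decomposition over a triangle *)

Ltac scalar_lra :=
  repeat match goal with
  | H : @eq ?T _ _ |- _ => unify T nat; clear H
  | H : @eq ?T _ _ |- _ => unify T ('rV[_]_(_))%type; clear H
  end; lra.

Ltac vec_lra := apply/rowP => ?; rewrite !mxE; scalar_lra.

Section Pillars.
Context {R : realType} {d : nat}.
Implicit Types (u v w x y z p : 'rV[R]_d) (s t : seq 'rV[R]_d).
Implicit Types (h : 'I_3 -> 'rV[R]_d) (P : 'I_3 -> seq 'rV[R]_d).

Definition i0 : 'I_3 := @Ordinal 3 0 isT.
Definition i1 : 'I_3 := @Ordinal 3 1 isT.
Definition i2 : 'I_3 := @Ordinal 3 2 isT.

Lemma I3P (k : 'I_3) : [\/ k = i0, k = i1 | k = i2].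
Proof.
by case: k => [[|[|[|//]]] hk]; [constructor 1|constructor 2|constructor 3];
  apply: val_inj.
Qed.

Record root_pillars P : Prop := RootPillars {
  rp_uniq : forall k, uniq (P k);
  rp_norm : forall k, {in P k, forall x, dot x x = 2};
  rp_in : forall k, {in P k &, forall x y,
    x != y -> dot x y = 0 \/ dot x y = -2};
  rp_out : forall k l x y, k != l -> x \in P k -> y \in P l ->
    is_sign (dot x y) }.

Definition all_roots P : seq 'rV[R]_d := P i0 ++ P i1 ++ P i2.

Lemma mem_all_roots P x : reflect (exists k, x \in P k) (x \in all_roots P).
Proof.
rewrite !mem_cat; apply: (iffP or3P) => [[]|[k]].
- by exists i0.
- by exists i1.
- by exists i2.
- by case: (I3P k) => -> xk; [constructor 1|constructor 2|constructor 3].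
Qed.

(** The signed sums of the orthonormal frame [h] form four lines, those of the
    triangle and of the negated sum of its vectors. Any other line is spanned
    by [h k + x] for a root [x] in exactly one pillar [P k]. *)
Record decomposition s h P : Prop := Decomposition {
  dec_h : forall k l, dot (h k) (h l) = (k == l)%:R;
  dec_base : forall a b c : R, is_sign a -> is_sign b -> is_sign c ->
    mem_pm s (a *: h i0 + b *: h i1 + c *: h i2);
  dec_mem : forall k x, x \in P k -> mem_pm s (h k + x);
  dec_orth : forall k x l, x \in P k -> dot x (h l) = 0;
  dec_roots : root_pillars P;
  dec_size : size s = (4 + (size (P i0) + size (P i1) + size (P i2)))%N;
  dec_dim : \dim (span s) = (3 + \dim (span (all_roots P)))%N }.

(** The product of [h k + x] and [h l + y] is [(k == l) + dot x y], and it must be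
    1 or -1 for different lines. *)
Lemma pillar_roots s h P : sign_system s ->
  (forall k l, dot (h k) (h l) = (k == l)%:R) ->
  (forall k, uniq (P k)) ->
  (forall k x, x \in P k -> mem_pm s (h k + x)) ->
  (forall k x l, x \in P k -> dot x (h l) = 0) ->
  root_pillars P.
Proof.
move=> es hh uP mP oP.
have key k l x y : x \in P k -> y \in P l ->
    (k = l /\ x = y) \/ is_sign ((k == l)%:R + dot x y).
  move=> xk yl; have dk : dot x (h l) = 0 by exact: oP xk.
  have dl : dot y (h l) = 0 by exact: oP yl.
  have dl' : dot y (h k) = 0 by exact: oP yl.
  have dk' : dot x (h k) = 0 by exact: oP xk.
  case: (mem_pm_dot es (mP _ _ xk) (mP _ _ yl)).
  - move=> e; left; have : dot (h k + x) (h l) = dot (h l + y) (h l) by rewrite e.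
    rewrite !dotDl dk dl !hh eqxx /=.
    case: eqVneq => [kl _|_ /= h0]; last by exfalso; lra.
    by split=> //; move: e; rewrite kl => /addrI.
  - move=> e; have : dot (h k + x) (h l) = dot (- (h l + y)) (h l) by rewrite e.
    by rewrite dotNl !dotDl dk dl !hh eqxx /=; case: eqVneq => _ /= h0; exfalso; lra.
  - by move=> e; right; move: e; rewrite !dotE (dotC (h k) y) dl' dk !hh !addr0 add0r.
have nP k x : x \in P k -> dot x x = 2.
  move=> xk; have := mem_pm_norm es (mP _ _ xk).
  by rewrite !dotE (dotC (h k) x) (oP _ _ _ xk) hh eqxx /=; lra.
split=> // [k x y xk yk ne|k l x y kl xk yl].
  case: (key _ _ _ _ xk yk) => [[_ e]|]; first by rewrite e eqxx in ne.
  by rewrite eqxx /= => -[] ?; [left|right]; lra.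
case: (key _ _ _ _ xk yl) => [[e _]|]; first by rewrite e eqxx in kl.
by rewrite (negPf kl) add0r.
Qed.

Lemma decomposition_dim h P :
  (forall k l, dot (h k) (h l) = (k == l)%:R) ->
  (forall k x l, x \in P k -> dot x (h l) = 0) ->
  \dim (span [:: h i0; h i1; h i2] + span (all_roots P)) =
  (3 + \dim (span (all_roots P)))%N.
Proof.
move=> hh oP; set H := [:: _; _; _].
have hH u : u \in H -> exists k, u = h k.
  by rewrite !inE => /or3P[] /eqP ->; [exists i0|exists i1|exists i2].
have hi : injective h.
  move=> k l e; have := hh k l; rewrite {}e hh eqxx /=.
  by case: eqVneq => //= _ h0; exfalso; lra.
have fH : free H.
  apply: (@free_gram _ _ _ (fun=> 1) 1 0).
  - by rewrite /= !inE !(inj_eq hi).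
  - exact: oner_neq0.
  - by rewrite mulr0 addr0 oner_neq0.
  - by move=> u _; exact: oner_neq0.
  - move=> _ _ /hH[k ->] /hH[l ->]; rewrite hh (inj_eq hi); ring.
have dH : \dim (span H) = 3%N by apply/eqP.
rewrite dimv_disjoint_sum ?dH//; apply/eqP; rewrite -subv0.
apply/subvP => v; rewrite memv_cap memv0 => /andP[vH vR].
apply/eqP/dot_eq0/(orth_span _ vH) => _ /hH[k ->]; rewrite dotC.
by apply: (orth_span _ vR) => x /mem_all_roots[l xl]; exact: oP xl.
Qed.

(** Unless [y] is a signed sum of the frame, its products with the four vectors
    [h0 + h1 + h2], [h0 - h1 - h2], [- h0 + h1 - h2], [- h0 - h1 + h2] are 1 or
    -1. Their total is zero, so two are 1 and two are -1, which leaves a single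
    nonzero coordinate. *)
Lemma frame_coordinates s h y : sign_system s -> mem_pm s y ->
  (forall k l, dot (h k) (h l) = (k == l)%:R) ->
  (forall a b c : R, is_sign a -> is_sign b -> is_sign c ->
    mem_pm s (a *: h i0 + b *: h i1 + c *: h i2)) ->
  ((forall k, is_sign (dot y (h k))) /\
   y = dot y (h i0) *: h i0 + dot y (h i1) *: h i1 + dot y (h i2) *: h i2) \/
  exists2 k, is_sign (dot y (h k)) & forall l, l != k -> dot y (h l) = 0.
Proof.
move=> es my hh B.
have eqcase a b c : is_sign a -> is_sign b -> is_sign c ->
    y = a *: h i0 + b *: h i1 + c *: h i2 ->
    (forall k, is_sign (dot y (h k))) /\
    y = dot y (h i0) *: h i0 + dot y (h i1) *: h i1 + dot y (h i2) *: h i2.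
  move=> sa sb sc ye.
  have [e0 e1 e2] : [/\ dot y (h i0) = a, dot y (h i1) = b & dot y (h i2) = c].
    by rewrite ye !dotE !hh /=; split; lra.
  by split=> [k|]; [case: (I3P k) => ->; rewrite ?e0 ?e1 ?e2|rewrite e0 e1 e2].
have sgN (a : R) : is_sign a -> is_sign (- a).
  by case=> ->; [right|left]; rewrite ?opprK.
have dcase a b c : is_sign a -> is_sign b -> is_sign c ->
    ((forall k, is_sign (dot y (h k))) /\
    y = dot y (h i0) *: h i0 + dot y (h i1) *: h i1 + dot y (h i2) *: h i2) \/
    is_sign (a * dot y (h i0) + b * dot y (h i1) + c * dot y (h i2)).
  move=> sa sb sc; case: (mem_pm_dot es my (B _ _ _ sa sb sc)).
  - by move=> ye; left; exact: eqcase ye.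
  - move=> ye; left; apply: (eqcase (- a) (- b) (- c)); try exact: sgN.
    by rewrite ye !scaleNr !opprD.
  - by rewrite !dotE; right.
have s1 : is_sign (1 : R) by left.
have s2 : is_sign (-1 : R) by right.
case: (dcase 1 1 1 s1 s1 s1) => [?|e1]; first by left.
case: (dcase 1 (-1) (-1) s1 s2 s2) => [?|e2]; first by left.
case: (dcase (-1) 1 (-1) s2 s1 s2) => [?|e3]; first by left.
case: (dcase (-1) (-1) 1 s2 s2 s1) => [?|e4]; first by left.
right; suff : [\/ is_sign (dot y (h i0)) /\ (dot y (h i1) = 0 /\ dot y (h i2) = 0),
    is_sign (dot y (h i1)) /\ (dot y (h i0) = 0 /\ dot y (h i2) = 0) |
    is_sign (dot y (h i2)) /\ (dot y (h i0) = 0 /\ dot y (h i1) = 0)].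
  by case=> -[sk [z1 z2]]; [exists i0|exists i1|exists i2] => // l;
    case: (I3P l) => ->.
move: e1 e2 e3 e4; rewrite /is_sign.
by case=> e1 [] e2 [] e3 [] e4;
  first [ exfalso; lra
        | constructor 1; split; [first [left; lra | right; lra] | split; lra]
        | constructor 2; split; [first [left; lra | right; lra] | split; lra]
        | constructor 3; split; [first [left; lra | right; lra] | split; lra] ].
Qed.

End Pillars.

Section Decompose.
Context {R : realType} {d : nat}.
Implicit Types (u v w x y z p : 'rV[R]_d) (s t : seq 'rV[R]_d).
Implicit Types (h : 'I_3 -> 'rV[R]_d) (P : 'I_3 -> seq 'rV[R]_d).

(** The frame consists of the half-sums of [p1] with the other three of the four
    vectors of sum zero. *)
Lemma frame_of_triangle s p1 p2 p3 : sign_system s -> triangle s p1 p2 p3 ->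
  mem_pm s (- (p1 + p2 + p3)) ->
  exists h, (forall k l, dot (h k) (h l) = (k == l)%:R) /\
    (forall a b c : R, is_sign a -> is_sign b -> is_sign c ->
      mem_pm s (a *: h i0 + b *: h i1 + c *: h i2)).
Proof.
move=> es [[m1 m2 m3] [d12 d13 d23]] m4.
have n1 := mem_pm_norm es m1; have n2 := mem_pm_norm es m2.
have n3 := mem_pm_norm es m3.
pose h (k : 'I_3) := [:: 2^-1 *: (p1 + p2); 2^-1 *: (p1 + p3);
  (- 2^-1) *: (p2 + p3)]`_k.
exists h; split.
  by move=> k l; case: (I3P k) => ->; case: (I3P l) => ->; rewrite /h /= !dotE
    ?(dotC p2 p1) ?(dotC p3 p1) ?(dotC p3 p2) ?n1 ?n2 ?n3 ?d12 ?d13 ?d23; lra.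
have eqm u v : mem_pm s u -> u = v -> mem_pm s v by move=> ? <-.
have eqm' u v : mem_pm s u -> - u = v -> mem_pm s v by rewrite -mem_pmN => ? <-.
move=> a b c [] -> [] -> [] ->; rewrite /h /=.
- by apply: (eqm _ _ m1); vec_lra.
- by apply: (eqm' _ _ m4); vec_lra.
- by apply: (eqm' _ _ m3); vec_lra.
- by apply: (eqm _ _ m2); vec_lra.
- by apply: (eqm' _ _ m2); vec_lra.
- by apply: (eqm _ _ m3); vec_lra.
- by apply: (eqm _ _ m4); vec_lra.
- by apply: (eqm' _ _ m1); vec_lra.
Qed.

Lemma size_partition s (b : pred 'rV[R]_d) (a : 'I_3 -> pred 'rV[R]_d) :
  {in s, forall y, b y + (a i0 y + a i1 y + a i2 y) = 1}%N ->
  size s = (count b s + (count (a i0) s + count (a i1) s + count (a i2) s))%N.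
Proof.
elim: s => //= y s IH H.
rewrite IH => [|z zs]; last by apply: H; rewrite inE zs orbT.
by have := H y (mem_head _ _); lia.
Qed.

(** Signs are normalized so that a vector of the pillar [k] has coordinate 1 on
    [h k], and a signed sum of the frame has coordinates of product 1. Four such
    sums exist, and the pillar [k] lists the differences [y - h k]. *)
Lemma decomposition_exists s h : sign_system s ->
  (forall k l, dot (h k) (h l) = (k == l)%:R) ->
  (forall a b c : R, is_sign a -> is_sign b -> is_sign c ->
    mem_pm s (a *: h i0 + b *: h i1 + c *: h i2)) ->
  exists P, decomposition s h P.
Proof.
move=> es hh B.
(* The product of the coordinates vanishes exactly on the pillars. *)
pose e y : R := let q := dot y (h i0) * dot y (h i1) * dot y (h i2) in
  if q == 0 then dot y (h i0) + dot y (h i1) + dot y (h i2) else q.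
have sgM (a b : R) : is_sign a -> is_sign b -> is_sign (a * b).
  by case=> -> [] ->; rewrite ?mulr1 ?mul1r ?mulrN1 ?opprK; [left|right|right|left].
have sg_neq0 (a : R) : is_sign a -> a != 0.
  by case=> ->; rewrite ?oppr_eq0 oner_eq0.
have i01 : i1 != i0 by []. have i02 : i2 != i0 by [].
have i10 : i0 != i1 by []. have i12 : i2 != i1 by [].
have i20 : i0 != i2 by []. have i21 : i1 != i2 by [].
have e_sign : {in s, forall y, is_sign (e y)}.
  move=> y ys; rewrite /e; case: (frame_coordinates es (mem_pmW ys) hh B).
    case=> sy _; rewrite ifF; first by do !apply: (sgM).
    by apply/negbTE; rewrite !mulf_neq0 ?sg_neq0.
  case=> k sk zk; move: sk (zk); case: (I3P k) => -> sk {}zk.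
  - by rewrite (zk i1)// (zk i2)// !(mul0r, mulr0) eqxx !addr0.
  - by rewrite (zk i0)// (zk i2)// !(mul0r, mulr0) eqxx add0r !addr0.
  - by rewrite (zk i0)// (zk i1)// !(mul0r, mulr0) eqxx !add0r.
pose s1 := [seq e y *: y | y <- s].
have es1 : sign_system s1 by exact: resign_sign_system.
have mm y : mem_pm s1 y = mem_pm s y by exact: resign_mem.
have coord y : y \in s1 ->
    [/\ forall k, is_sign (dot y (h k)),
     dot y (h i0) * dot y (h i1) * dot y (h i2) = 1 &
     y = dot y (h i0) *: h i0 + dot y (h i1) *: h i1 + dot y (h i2) *: h i2] \/
    exists2 k, dot y (h k) = 1 & forall l, l != k -> dot y (h l) = 0.
  move=> /mapP[z zs ->]; rewrite !dotZl.
  have ez := e_sign z zs.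
  case: (frame_coordinates es (mem_pmW zs) hh B) => [[sz ze]|[k sk zk]].
    left; split=> [k||]; first by rewrite dotZl; exact: sgM.
      have -> : e z = dot z (h i0) * dot z (h i1) * dot z (h i2).
        by rewrite /e ifF//; apply/negbTE; rewrite !mulf_neq0 ?sg_neq0.
      by case: (sz i0) => ->; case: (sz i1) => ->; case: (sz i2) => ->; lra.
    by rewrite {2}ze -!scalerA -!scalerDr.
  right; exists k; last by move=> l lk; rewrite dotZl zk ?mulr0.
  have -> : e z = dot z (h k).
    rewrite /e; move: zk; case: (I3P k) => -> zk.
    - by rewrite (zk i1)// (zk i2)// !(mul0r, mulr0) eqxx !addr0.
    - by rewrite (zk i0)// (zk i2)// !(mul0r, mulr0) eqxx add0r !addr0.
    - by rewrite (zk i0)// (zk i1)// !(mul0r, mulr0) eqxx !add0r.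
  by rewrite dotZl; case: sk => ->; lra.
pose b y := [forall l, dot y (h l) != 0].
pose a k y := [forall l, dot y (h l) == (l == k)%:R].
pose P k := [seq y - h k | y <- s1 & a k y].
have aP k y : a k y -> forall l, dot y (h l) = (l == k)%:R.
  by move=> /forallP H l; apply/eqP.
have bP y : y \in s1 -> b y ->
    [/\ forall k, is_sign (dot y (h k)),
     dot y (h i0) * dot y (h i1) * dot y (h i2) = 1 &
     y = dot y (h i0) *: h i0 + dot y (h i1) *: h i1 + dot y (h i2) *: h i2].
  move=> ys /forallP nb; case: (coord y ys) => // -[k _ zk].
  by have [l lk] : exists l, l != k;
    [case: (I3P k) => ->; [exists i1|exists i0|exists i0]|
     have := nb l; rewrite zk ?eqxx].
have uP k : uniq (P k).
  by rewrite map_inj_uniq; [apply/filter_uniq/(sign_system_uniq es1)|exact: addIr].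
have memP k x : x \in P k -> [/\ a k (h k + x), h k + x \in s1 &
    forall l, dot x (h l) = 0].
  move=> /mapP[y]; rewrite mem_filter => /andP[ay ys ->].
  rewrite addrC subrK; split=> // l.
  by rewrite dotDl dotNl (aP _ _ ay) hh eq_sym subrr.
have oP k x l : x \in P k -> dot x (h l) = 0 by case/memP.
have mP k x : x \in P k -> mem_pm s (h k + x).
  by case/memP => _ xs _; rewrite -mm mem_pmW.
exists P; split=> //.
- exact: (pillar_roots es).
- have -> : size s = size s1 by rewrite size_map.
  rewrite (@size_partition s1 b a); last first.
    move=> y ys; case: (coord y ys) => [[sy _ _]|[k yk zk]].
      have -> : b y by apply/forallP => l; exact: sg_neq0.
      have na k : a k y = false.
        apply/negbTE/forallPn; case: (I3P k) => ->; [exists i1|exists i0|exists i0];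
          exact: sg_neq0.
      by rewrite !na.
    have dy l : dot y (h l) = (l == k)%:R by case: eqVneq => [->//|/zk].
    have -> : b y = false.
      apply/negbTE/forallPn; case: (I3P k) dy => -> dy; [exists i1|exists i0|exists i0];
          by rewrite dy eqxx.
    have ak l : a l y = (l == k).
      apply/forallP/eqP => [H|->]; last by move=> l'; rewrite dy.
      have := H l; rewrite dy eqxx; case: (eqVneq l k) => //= _ /eqP h0.
      by exfalso; lra.
    by rewrite !ak; case: (I3P k) => ->.
  rewrite !size_map !size_filter; congr (_ + _)%N.
  pose q (x y : R) := x *: h i0 + y *: h i1 + (x * y) *: h i2.
  have dq (x y : R) : [/\ dot (q x y) (h i0) = x, dot (q x y) (h i1) = y &
      dot (q x y) (h i2) = x * y].
    by rewrite /q !dotE !hh /=; split; lra.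
  have q_inj (x y x' y' : R) : q x y = q x' y' -> x = x' /\ y = y'.
    by move=> E; have := dq x y; have [e0 e1 _] := dq x' y'; rewrite E e0 e1; case.
  rewrite -size_filter.
  suff /perm_size -> : perm_eq [seq y <- s1 | b y]
      [:: q 1 1; q 1 (-1); q (-1) 1; q (-1) (-1)] by [].
  apply: uniq_perm; first by apply/filter_uniq/(sign_system_uniq es1).
    have n11 : (1 : R) <> -1 by lra.
    rewrite /= !inE !negb_or !andbT; apply/and3P; split; try (apply/and3P; split);
      try (apply/andP; split); apply/eqP => /q_inj []; intros; by lra.
  have sgN1 : is_sign (-1 : R) by right.
  have sg1 : is_sign (1 : R) by left.
  have qs (x y : R) : is_sign x -> is_sign y -> (q x y \in s1) && b (q x y).
    move=> sx sy; have [q0 q1 q2] := dq x y.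
    have sq k : is_sign (dot (q x y) (h k)).
      by case: (I3P k) => ->; rewrite ?q0 ?q1 ?q2 //; exact: sgM.
    have bq : b (q x y) by apply/forallP => k; exact: sg_neq0.
    rewrite bq andbT.
    have : mem_pm s1 (q x y) by rewrite mm; apply: B => //; exact: sgM.
    case/orP => // Nq; exfalso.
    have bN : b (- q x y) by apply/forallP => k; rewrite dotNl oppr_eq0 sg_neq0.
    have [_ + _] := bP _ Nq bN; rewrite !dotNl q0 q1 q2.
    by case: sx => ->; case: sy => ->; lra.
  move=> y; rewrite mem_filter !inE; apply/andP/idP => [[yb ys]|].
    have [sy py ye] := bP _ ys yb.
    have c2 : dot y (h i2) = dot y (h i0) * dot y (h i1).
      by move: py; case: (sy i0) => ->; case: (sy i1) => ->; lra.
    have {}ye : y = q (dot y (h i0)) (dot y (h i1)) by rewrite {1}ye c2.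
    by rewrite ye; case: (sy i0) => ->; case: (sy i1) => ->; rewrite eqxx ?orbT.
  by case/or4P => /eqP ->; apply/andP; rewrite andbC; exact: qs.
- rewrite -(decomposition_dim hh oP) -(resign_span e_sign) -/s1.
  congr (\dim _); apply/eqP; rewrite eqEsubv; apply/andP; split.
    apply/span_subvP => y ys.
    have hs k : h k \in (span [:: h i0; h i1; h i2])%VS.
      by apply: memv_span; case: (I3P k) => ->; rewrite !inE eqxx ?orbT.
    case: (coord y ys) => [[_ _ ->]|[k yk zk]].
      apply: (subvP (addvSl _ _)).
      by apply: memvD; [apply: memvD|]; apply: memvZ.
    rewrite -(subrK (h k) y) addrC; apply: memv_add => //.
    apply/memv_span/mem_all_roots; exists k; apply/mapP; exists y => //.
    rewrite mem_filter ys andbT; apply/forallP => l.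
    by case: (eqVneq l k) => [->|/zk ->]; rewrite ?yk.
  have hs k : h k \in span s1.
    have sgN1 : is_sign (-1 : R) by right.
    have sg1 : is_sign (1 : R) by left.
    have M (x y z : R) : is_sign x -> is_sign y -> is_sign z ->
        x *: h i0 + y *: h i1 + z *: h i2 \in span s1.
      by move=> sx sy sz; apply: mem_pm_span; rewrite mm; exact: B.
    have M1 := M 1 1 1 sg1 sg1 sg1.
    have M2 := M 1 (-1) (-1) sg1 sgN1 sgN1.
    have M3 := M (-1) 1 (-1) sgN1 sg1 sgN1.
    have M4 := M (-1) (-1) 1 sgN1 sgN1 sg1.
    have half u v : u \in span s1 -> v \in span s1 -> 2^-1 *: (u + v) \in span s1.
      by move=> us vs; apply/memvZ/memvD.
    have eqm u v : u \in span s1 -> u = v -> v \in span s1 by move=> ? <-.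
    case: (I3P k) => ->.
    + by apply: eqm (half _ _ M1 M2) _; vec_lra.
    + by apply: eqm (half _ _ M1 M3) _; vec_lra.
    + by apply: eqm (half _ _ M1 M4) _; vec_lra.
  rewrite subv_add; apply/andP; split; apply/span_subvP => x.
    by rewrite !inE => /or3P[] /eqP ->.
  case/mem_all_roots => k /memP[_ xs _]; rewrite -(addKr (h k) x).
  by apply: memvD; [rewrite memvN|exact: memv_span].
Qed.

End Decompose.

(** * Pillars of roots *)

Section Roots.
Context {R : realType} {d : nat}.
Implicit Types (u v w x y z q : 'rV[R]_d) (s t L Q : seq 'rV[R]_d).
Implicit Types (P : 'I_3 -> seq 'rV[R]_d).

Record orth_roots Q : Prop := OrthRoots {
  or_uniq : uniq Q;
  or_norm : {in Q, forall x, dot x x = 2};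
  or_orth : {in Q &, forall x y, x != y -> dot x y = 0} }.

(** From each pair of opposite roots only the one that comes first in [L] is kept. *)
Lemma root_representatives L : uniq L -> {in L, forall x, dot x x = 2} ->
  {in L &, forall x y, x != y -> dot x y = 0 \/ dot x y = -2} ->
  exists Q, [/\ orth_roots Q, {subset Q <= L}, {in L, forall x, mem_pm Q x},
    (size L <= 2 * size Q)%N &
    size L = (2 * size Q)%N -> {in Q, forall x, - x \in L}].
Proof.
move=> uL nL dL; pose a x := (index x L <= index (- x) L)%N.
pose Q := [seq x <- L | a x]; pose N := [seq x <- L | ~~ a x].
have QL : {subset Q <= L} by move=> x; rewrite mem_filter => /andP[].
have NP x : x \in L -> ~~ a x -> - x \in L /\ - x \in Q.
  rewrite /a -ltnNge => xL lt; have xL' : - x \in L.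
    by rewrite -index_mem (ltn_trans lt)// index_mem.
  by rewrite mem_filter xL' /a opprK (ltnW lt).
have sLE : size L = (size Q + size N)%N by rewrite !size_filter count_predC.
have sN : (size N <= count (fun x => - x \in L) Q)%N.
  rewrite -size_filter -(size_map -%R); apply: uniq_leq_size.
    by rewrite (map_inj_uniq oppr_inj) filter_uniq.
  move=> _ /mapP[x + ->]; rewrite mem_filter => /andP[ax xL].
  by have [h1 h2] := NP _ xL ax; rewrite mem_filter opprK xL h2.
have cQ := count_size (fun x => - x \in L) Q.
exists Q; split=> //.
- split; first exact: filter_uniq.
    by move=> x /QL; exact: nL.
  move=> x y xQ yQ ne; case: (dL x y (QL _ xQ) (QL _ yQ) ne) => // xy.
  have xn := nL _ (QL _ xQ); have yn := nL _ (QL _ yQ).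
  have e : x = - y by exact: dot_eq_opp xn yn xy.
  move: xQ yQ; rewrite !mem_filter /a e opprK => /andP[l1 yL] /andP[l2 yL'].
  have := anti_leq (introT andP (conj l1 l2)).
  by move=> e'; move: (nth_index 0 yL) ne; rewrite e' nth_index// e => <-; rewrite eqxx.
- move=> x xL; case ax : (a x).
    by apply: mem_pmW; rewrite mem_filter ax.
  by rewrite -mem_pmN; apply/mem_pmW/(NP _ xL (negbT ax)).2.
- by lia.
- move=> sE; have : all (fun x => - x \in L) Q by rewrite all_count; apply/eqP; lia.
  by move/allP.
Qed.

Section OrthRoots.
Variable Q : seq 'rV[R]_d.
Hypothesis oQ : orth_roots Q.

Lemma orth_roots_free : free Q.
Proof.
apply: (@free_gram _ _ _ (fun=> 1) 2 0); first exact: or_uniq oQ.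
- by rewrite pnatr_eq0.
- by rewrite mulr0 addr0 pnatr_eq0.
- by move=> *; exact: oner_neq0.
- move=> u v uQ vQ; have [<-|ne] := eqVneq u v.
    by rewrite (or_norm oQ uQ) /=; ring.
  by rewrite (or_orth oQ uQ vQ ne) /=; ring.
Qed.

Lemma orth_roots_dim : \dim (span Q) = size Q.
Proof. exact/eqP/orth_roots_free. Qed.

Definition root_proj v : 'rV[R]_d := \sum_(q <- Q) (dot v q / 2) *: q.

Lemma root_proj_span v : root_proj v \in span Q.
Proof. by rewrite /root_proj big_seq memv_suml// => q qQ; rewrite memvZ ?memv_span. Qed.

Lemma residual_orth v q : q \in Q -> dot (v - root_proj v) q = 0.
Proof.
move=> qQ; rewrite dotDl dotNl /root_proj dot_suml (bigD1_seq q) ?(or_uniq oQ)//=.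
rewrite dotZl (or_norm oQ qQ) big_seq_cond big1 => [|p /andP[pQ pq]]; first lra.
by rewrite dotZl (or_orth oQ pQ qQ pq) mulr0.
Qed.

Lemma residual_dot v w :
  dot (v - root_proj v) (w - root_proj w) = dot v w - (\sum_(q <- Q) dot v q * dot w q) / 2.
Proof.
have p0 : dot (v - root_proj v) (root_proj w) = 0.
  rewrite dotC; apply: (orth_span (s := Q)); last exact: root_proj_span.
  by move=> q qQ; rewrite dotC; exact: residual_orth.
rewrite dotDr dotNr p0 oppr0 addr0 dotDl dotNl; congr (_ - _).
rewrite /root_proj dot_suml mulr_suml; apply: eq_bigr => q _.
by rewrite dotZl (dotC q); lra.
Qed.

Lemma root_proj_id v : v \in span Q -> v = root_proj v.
Proof.
move=> vQ; apply/eqP; rewrite -subr_eq0; apply/eqP/dot_eq0.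
apply: (orth_span (s := Q)); last by rewrite memvB ?root_proj_span.
by move=> q qQ; rewrite dotC residual_orth.
Qed.

(** Each product 1 or -1 with a root of norm 2 takes away 1/2 from the norm of [y]. *)
Lemma residual_norm y : dot y y = 2 -> {in Q, forall q, is_sign (dot y q)} ->
  dot (y - root_proj y) (y - root_proj y) = 2 - (size Q)%:R / 2.
Proof.
move=> yy yQ; rewrite residual_dot yy; congr (_ - _ / 2).
rewrite big_seq (eq_bigr (fun=> 1)); last by move=> q /yQ [] ->; lra.
by rewrite -big_seq big_const_seq count_predT iter_addr_0.
Qed.

(** The residuals of [y] and [z] attain the Cauchy-Schwarz bound, so they agree
    up to sign. *)
Lemma parallel_residual y z (c : R) :
  dot (y - root_proj y) (y - root_proj y) = c -> dot (z - root_proj z) (z - root_proj z) = c ->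
  dot (y - root_proj y) (z - root_proj z) = c \/ dot (y - root_proj y) (z - root_proj z) = - c ->
  z \in span (y :: Q).
Proof.
move=> yc zc yz.
have sQ p : p \in span Q -> p \in span (y :: Q).
  by move=> pQ; rewrite span_cons (subvP (addvSr _ _)).
have yr : y - root_proj y \in span (y :: Q).
  by rewrite memvB ?(sQ _ (root_proj_span _))// memv_span ?mem_head.
rewrite -(subrK (root_proj z) z) memvD ?(sQ _ (root_proj_span _))//.
case: yz => [/(dot_eq_same yc zc) <-//|].
by rewrite dotC => /(dot_eq_opp zc yc) ->; rewrite memvN.
Qed.

Lemma orth_roots_le4 y : dot y y = 2 -> {in Q, forall q, is_sign (dot y q)} ->
  (size Q <= 4)%N.
Proof.
move=> yy yQ; have := dot_ge0 (y - root_proj y); rewrite residual_norm// => h.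
by rewrite -(ler_nat R); lra.
Qed.

Lemma orth_roots_span4 y : dot y y = 2 -> {in Q, forall q, is_sign (dot y q)} ->
  y \in span Q -> size Q = 4%N.
Proof.
move=> yy yQ /root_proj_id e; have := residual_norm yy yQ.
rewrite -e subrr dot0l => h; apply/eqP; rewrite -(eqr_nat R); apply/eqP; lra.
Qed.

(** Four orthogonal roots exhaust the norm 2 of [y]. *)
Lemma orth_roots4_span y : dot y y = 2 -> {in Q, forall q, is_sign (dot y q)} ->
  size Q = 4%N -> y = root_proj y.
Proof.
move=> yy yQ s4; apply/eqP; rewrite -subr_eq0; apply/eqP/dot_eq0.
by rewrite residual_norm// s4; lra.
Qed.

End OrthRoots.

(** The difference is half an odd integer. *)
Lemma residual_three_signs (a b c t : R) :
  is_sign a -> is_sign b -> is_sign c ->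
  [\/ is_sign t, t = 0, t = 2 | t = -2] ->
  - 2^-1 <= t - (a + (b + (c + 0))) / 2 -> t - (a + (b + (c + 0))) / 2 <= 2^-1 ->
  t - (a + (b + (c + 0))) / 2 = 2^-1 \/ t - (a + (b + (c + 0))) / 2 = - 2^-1.
Proof.
by case=> -> [] -> [] -> [[]|||] -> b1 b2;
  first [exfalso; lra | left; lra | right; lra].
Qed.

Lemma sign_product2 (a b c e : R) :
  is_sign a -> is_sign b -> is_sign c -> is_sign e ->
  a * c + b * e = 0 \/ (a * c + b * e = 2 \/ a * c + b * e = -2).
Proof.
by case=> -> [] -> [] -> [] ->;
  first [left; lra | right; left; lra | right; right; lra].
Qed.

(** Two orthogonal sign vectors in the plane are (1, 1) and (1, -1) up to sign,
    and every sign vector is a multiple of one of them. *)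
Lemma sign_orth2 (a b c e x y : R) : is_sign a -> is_sign b -> is_sign c ->
  is_sign e -> is_sign x -> is_sign y -> a * c + b * e = 0 ->
  a * x + b * y = 0 \/ c * x + e * y = 0.
Proof.
by case=> -> [] -> [] -> [] -> [] -> [] -> H; first [exfalso; lra | left; lra | right; lra].
Qed.

Section Several.
Variables (P : 'I_3 -> seq 'rV[R]_d).
Hypothesis rP : root_pillars P.

Lemma pillar_representatives k : exists Q, [/\ orth_roots Q, {subset Q <= P k},
  {in P k, forall x, mem_pm Q x}, (size (P k) <= 2 * size Q)%N &
    size (P k) = (2 * size Q)%N -> {in Q, forall x, - x \in P k}].
Proof.
by apply: root_representatives; [exact: rp_uniq|exact: rp_norm|exact: rp_in].
Qed.

Lemma pillar_opp_eq k x q : x \in P k -> q \in P k -> x != q -> dot x q != 0 ->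
  x = - q.
Proof.
move=> xk qk ne nz; case: (rp_in rP xk qk ne) => h; first by rewrite h eqxx in nz.
apply: dot_eq_opp (rp_norm rP xk) (rp_norm rP qk) h.
Qed.

(** For [z] outside the pillar [k] the residuals of [y] and [z] have norm 1/2, and
    their product is half an odd integer: they agree up to sign. If a root [z]
    of the pillar [k] is orthogonal to [Q], the four roots exhaust [y], so that
    [z] is a combination of [y] and [Q]. *)
Lemma span_three k l Q y : k != l -> orth_roots Q -> {subset Q <= P k} ->
  size Q = 3%N -> y \in P l -> {in all_roots P, forall x, x \in span (y :: Q)}.
Proof.
move=> kl oQ QP s3 yl.
have yn := rp_norm rP yl.
have sgQ j z : j != k -> z \in P j -> {in Q, forall q, is_sign (dot z q)}.
  by move=> jk zj q /QP qk; exact: (rp_out rP jk).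
have lk : l != k by rewrite eq_sym.
have yr := residual_norm oQ yn (sgQ _ _ lk yl).
have Qs p : p \in span Q -> p \in span (y :: Q).
  by move=> pQ; rewrite span_cons (subvP (addvSr _ _)).
move=> z /mem_all_roots[j zj]; have zn := rp_norm rP zj.
have [jk|jk] := eqVneq j k.
  rewrite {}jk in zj.
  case zQ : (z \in Q); first by apply/Qs/memv_span.
  case zQ' : (- z \in Q); first by rewrite -memvN; apply/Qs/memv_span.
  have z0 q : q \in Q -> dot z q = 0.
    move=> qQ; apply/eqP/negPn/negP => nz.
    have ne : z != q by apply: contraFneq zQ => ->.
    by move: zQ'; rewrite (pillar_opp_eq zj (QP _ qQ) ne nz) opprK qQ.
  have oZ : orth_roots (z :: Q).
    split=> [|p|p q]; first by rewrite cons_uniq zQ (or_uniq oQ).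
      by rewrite inE => /orP[/eqP -> //|]; exact: (or_norm oQ).
    rewrite !inE => /orP[/eqP ->|pQ] /orP[/eqP ->|qQ].
    - by rewrite eqxx.
    - by move=> _; exact: z0.
    - by move=> _; rewrite dotC; exact: z0.
    - exact: (or_orth oQ).
  have sy : {in z :: Q, forall q, is_sign (dot y q)}.
    move=> q; rewrite inE => /orP[/eqP ->|]; first exact: (rp_out rP lk).
    exact: (sgQ _ _ lk yl).
  have := orth_roots4_span oZ yn sy; rewrite /= s3 => /(_ erefl).
  rewrite /root_proj big_cons -/(root_proj Q y) => /eqP; rewrite -subr_eq => /eqP e.
  have -> : z = (2 * dot y z) *: (y - root_proj Q y).
    by rewrite e scalerA; case: (sy z (mem_head _ _)) => ->;
      rewrite [_ * _](_ : _ = 1) ?scale1r//; lra.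
  by rewrite memvZ// memvB ?(Qs _ (root_proj_span _ _))// memv_span ?mem_head.
have zr := residual_norm oQ zn (sgQ _ _ jk zj).
have c2 : 2 - (size Q)%:R / 2 = 2^-1 :> R by rewrite s3; lra.
rewrite c2 in yr zr; apply: (parallel_residual yr zr).
have bd := dot_bounded (c := 2^-1) _ yr zr.
have {}bd : - 2^-1 <= dot (y - root_proj Q y) (z - root_proj Q z) <= 2^-1 by apply: bd; lra.
move: bd; rewrite residual_dot //.
have : [\/ is_sign (dot y z), dot y z = 0, dot y z = 2 | dot y z = -2].
  have [<-|ne] := eqVneq y z; first by constructor 3.
  have [lj|lj] := eqVneq l j.
    rewrite -lj in zj; case: (rp_in rP yl zj ne) => ->; [constructor 2|constructor 4]=> //.
  by constructor 1; exact: (rp_out rP lj yl zj).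
have sy := sgQ _ _ lk yl; have sz := sgQ _ _ jk zj.
clear - s3 sy sz.
case: Q s3 sy sz => [|q1 [|q2 [|q3 []]]] //= _ sy sz.
rewrite !big_cons big_nil.
have m1 : q1 \in [:: q1; q2; q3] by rewrite !inE eqxx ?orbT.
have m2 : q2 \in [:: q1; q2; q3] by rewrite !inE eqxx ?orbT.
have m3 : q3 \in [:: q1; q2; q3] by rewrite !inE eqxx ?orbT.
have sM q : q \in [:: q1; q2; q3] -> is_sign (dot y q * dot z q).
  by move=> qm; case: (sy q qm) => ->; case: (sz q qm) => ->;
    first [left; lra | right; lra].
move=> yz /andP[b1 b2].
exact: (residual_three_signs (sM _ m1) (sM _ m2) (sM _ m3) yz b1 b2).
Qed.

(** Residuals have norm 1 here, and their products are integers. If two orthogonal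
    roots of the pillar [l] have residuals that are not parallel, their sign
    vectors with respect to [Q] are orthogonal. A root of the third pillar is then
    orthogonal on [Q] to one of the two, and its residual is parallel to the
    residual of that one. *)
Lemma span_two k l Q : k != l -> orth_roots Q -> {subset Q <= P k} ->
  {in P k, forall x, mem_pm Q x} -> size Q = 2%N ->
  (forall Q', orth_roots Q' -> {subset Q' <= P l} -> (size Q' <= 2)%N) ->
  (exists y, {in P l, forall x, x \in span (y :: Q)}) \/
  (exists y1 y2, {in all_roots P, forall x, x \in span [:: y1, y2 & Q]}).
Proof.
move=> kl oQ QP PQ s2 le2.
have sgQ j z : j != k -> z \in P j -> {in Q, forall q, is_sign (dot z q)}.
  by move=> jk zj q /QP qk; exact: (rp_out rP jk).
have lk : l != k by rewrite eq_sym.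
have c1 : 2 - (size Q)%:R / 2 = 1 :> R by rewrite s2; lra.
have rn j z : j != k -> z \in P j -> dot (z - root_proj Q z) (z - root_proj Q z) = 1.
  by move=> jk zj; rewrite (residual_norm oQ (rp_norm rP zj) (sgQ _ _ jk zj)).
have [Q' [oQ' QP' PQ' _ _]] := pillar_representatives l.
have := le2 _ oQ' QP'; case: Q' oQ' QP' PQ' => [|y1 [|y2 []]] //= oQ' QP' PQ' _.
- by left; exists 0 => x /PQ'.
- left; exists y1 => x /PQ'; rewrite /mem_pm !inE => /orP[] /eqP.
    by move=> ->; rewrite memv_span ?mem_head.
  by move=> e; rewrite -memvN e memv_span ?mem_head.
have m1 : y1 \in [:: y1; y2] by rewrite mem_head.
have m2 : y2 \in [:: y1; y2] by rewrite !inE eqxx orbT.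
have y1l := QP' _ m1; have y2l := QP' _ m2.
have y12 : y1 != y2 by have := or_uniq oQ'; rewrite /= inE andbT.
have d12 := or_orth oQ' m1 m2 y12.
have r1 := rn _ _ lk y1l; have r2 := rn _ _ lk y2l.
have s1 := sgQ _ _ lk y1l; have s2' := sgQ _ _ lk y2l.
pose S y z := \sum_(q <- Q) dot y q * dot z q.
have r12 : dot (y1 - root_proj Q y1) (y2 - root_proj Q y2) = 0 - S y1 y2 / 2.
  by rewrite residual_dot// d12.
have [q1 [q2 [Q2 SE]]] : exists q1 q2, Q = [:: q1; q2] /\
    forall y z, S y z = dot y q1 * dot z q1 + dot y q2 * dot z q2.
  rewrite /S; clear - s2; case: Q s2 => [|q1 [|q2 []]] //= _.
  by exists q1, q2; split=> // y z; rewrite !big_cons big_nil addr0.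
have mq1 : q1 \in Q by rewrite Q2 mem_head.
have mq2 : q2 \in Q by rewrite Q2 !inE eqxx orbT.
have [S0|S0] : S y1 y2 = 0 \/ (S y1 y2 = 2 \/ S y1 y2 = -2).
- by rewrite SE; apply: sign_product2; auto.
- right; exists y1, y2.
  have sub1 x : x \in span (y1 :: Q) -> x \in span [:: y1, y2 & Q].
    apply: subvP; apply: sub_span => z; rewrite !inE => /orP[->//|->].
    by rewrite !orbT.
  have sub2 x : x \in span (y2 :: Q) -> x \in span [:: y1, y2 & Q].
    by apply: subvP; apply: sub_span => z; rewrite !inE => ->; rewrite orbT.
  have subQ x : mem_pm Q x -> x \in span [:: y1, y2 & Q].
    by move=> /mem_pm_span; apply/subvP/sub_span => z zQ; rewrite !inE zQ !orbT.
  move=> z /mem_all_roots[j zj].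
  have [jk|jk] := eqVneq j k; first by apply/subQ/PQ; rewrite -jk.
  have [jl|jl] := eqVneq j l.
    rewrite jl in zj; have := PQ' _ zj; rewrite /mem_pm !inE.
    case/orP=> /orP[] /eqP e; [rewrite e|rewrite e|rewrite -memvN e|rewrite -memvN e];
      by rewrite memv_span // !inE eqxx ?orbT.
  have rz := rn _ _ jk zj; have sz := sgQ _ _ jk zj.
  have [e|e] : S y1 z = 0 \/ S y2 z = 0.
  + by rewrite !SE in S0 *; apply: sign_orth2 S0; auto.
  + apply/sub1/(parallel_residual r1 rz); rewrite residual_dot// -/(S y1 z) e.
    have lj : l != j by rewrite eq_sym.
    by case: (rp_out rP lj y1l zj) => ->; [left|right]; lra.
  + apply/sub2/(parallel_residual r2 rz); rewrite residual_dot// -/(S y2 z) e.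
    have lj : l != j by rewrite eq_sym.
    by case: (rp_out rP lj y2l zj) => ->; [left|right]; lra.
left; exists y1.
have y2s : y2 \in span (y1 :: Q).
  apply: (parallel_residual r1 r2); rewrite r12.
  by case: S0 => ->; [right|left]; lra.
move=> x /PQ'; rewrite /mem_pm !inE.
by case/orP=> /orP[] /eqP e; [rewrite e|rewrite e|rewrite -memvN e|rewrite -memvN e];
  first [exact: y2s | by rewrite memv_span ?mem_head].
Qed.

Lemma dim_le_size (U : seq 'rV[R]_d) (V : seq 'rV[R]_d) :
  {in U, forall x, x \in span V} -> (\dim (span U) <= size V)%N.
Proof.
by move=> UV; apply: leq_trans (dim_span V); apply/dimvS/span_subvP.
Qed.

(** Three orthogonal roots in one pillar and a root outside span everything. If no
    pillar has three, two orthogonal roots in one pillar need at most two further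
    vectors, and without them every pillar spans at most a line. *)
Lemma several_pillars_dim k l x y : k != l -> x \in P k -> y \in P l ->
  (\dim (span (all_roots P)) <= 4)%N.
Proof.
move=> kl xk yl.
have other j : exists j' z, j != j' /\ z \in P j'.
  have [->|jk] := eqVneq j k; first by exists l, y.
  by exists k, x.
case: (pselect (exists j Q, [/\ orth_roots Q, {subset Q <= P j} & size Q = 3%N])).
  move=> [j [Q [oQ QP s3]]]; have [j' [z [jj' zj']]] := other j.
  by have := dim_le_size (span_three jj' oQ QP s3 zj'); rewrite /= s3.
move=> no3.
have le2 j Q : orth_roots Q -> {subset Q <= P j} -> (size Q <= 2)%N.
  move=> oQ QP; rewrite leqNgt; apply/negP => gt2; apply: no3.
  exists j, (take 3 Q); split; last by rewrite size_takel.
    split; first by rewrite take_uniq ?(or_uniq oQ).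
      by move=> z /mem_take; exact: (or_norm oQ).
    by move=> u v /mem_take uQ /mem_take; exact: (or_orth oQ).
  by move=> z /mem_take /QP.
case: (pselect (exists j Q, [/\ orth_roots Q, {subset Q <= P j},
    {in P j, forall x, mem_pm Q x} & size Q = 2%N])); last first.
  move=> no2.
  have le1 j : exists Q, {in P j, forall x, x \in span Q} /\ (size Q <= 1)%N.
    have [Q [oQ QP PQ _ _]] := pillar_representatives j.
    exists Q; split; first by move=> z /PQ /mem_pm_span.
    rewrite -ltnS ltn_neqAle (le2 _ _ oQ QP) andbT; apply/eqP => s2.
    by apply: no2; exists j, Q.
  have [Q0 [h0 l0]] := le1 i0; have [Q1 [h1 l1]] := le1 i1.
  have [Q2 [h2 l2]] := le1 i2.
  apply: (leq_trans (dim_le_size (V := Q0 ++ Q1 ++ Q2) _)); last first.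
    by rewrite !size_cat; lia.
  move=> z /mem_all_roots[j]; have sb A : {subset A <= Q0 ++ Q1 ++ Q2} ->
      z \in span A -> z \in span (Q0 ++ Q1 ++ Q2).
    by move=> /sub_span /subvP; apply.
  by case: (I3P j) => -> => [/h0|/h1|/h2]; apply: sb => u uA;
    rewrite !mem_cat uA ?orbT.
move=> [j [Q [oQ QP PQ s2]]].
have [l1 [l2 [jl1 jl2 l1l2]]] : exists l1 l2 : 'I_3, [/\ j != l1, j != l2 & l1 != l2].
  by case: (I3P j) => ->; [exists i1, i2|exists i0, i2|exists i0, i1].
case: (span_two jl1 oQ QP PQ s2 (le2 l1)) => [[y1 Y1]|[y1 [y2 Y]]]; last first.
  by have := dim_le_size Y; rewrite /= s2.
case: (span_two jl2 oQ QP PQ s2 (le2 l2)) => [[y2 Y2]|[y1' [y2 Y]]]; last first.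
  by have := dim_le_size Y; rewrite /= s2.
suff : {in all_roots P, forall x, x \in span [:: y1, y2 & Q]}.
  by move/dim_le_size; rewrite /= s2.
move=> z /mem_all_roots[m zm].
have [mj|mj] := eqVneq m j.
  rewrite mj in zm; have /mem_pm_span := PQ _ zm; apply/subvP/sub_span => u uQ.
  by rewrite !inE uQ !orbT.
have [ml1|ml1] := eqVneq m l1.
  rewrite ml1 in zm; have := Y1 _ zm; apply/subvP/sub_span => u.
  by rewrite !inE => /orP[->//|->]; rewrite !orbT.
have ml2 : m = l2.
  by move: jl1 jl2 l1l2 mj ml1; case: (I3P m) => ->; case: (I3P j) => ->;
    case: (I3P l1) => ->; case: (I3P l2) => ->.
rewrite ml2 in zm; have := Y2 _ zm; apply/subvP/sub_span => u.
by rewrite !inE => ->; rewrite orbT.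
Qed.

(** If the orthogonal roots [Q] of one pillar span everything, then a root of
    another pillar has norm [size Q / 2], and [Q] has four elements. *)
Lemma pillar_size k l x y : k != l -> x \in P k -> y \in P l ->
  let m := \dim (span (all_roots P)) in
  forall j, exists Q, [/\ orth_roots Q, {subset Q <= P j},
    (size (P j) <= 2 * size Q)%N,
    size (P j) = (2 * size Q)%N -> {in Q, forall x, - x \in P j} &
    (size Q <= if m == 4 then 4 else m.-1)%N].
Proof.
move=> kl xk yl m j.
have [j' [z [jj' zj']]] : exists j' z, j != j' /\ z \in P j'.
  have [->|jk] := eqVneq j k; first by exists l, y.
  by exists k, x.
have [Q [oQ QP PQ sQ sE]] := pillar_representatives j.
have zn := rp_norm rP zj'.
have zQ : {in Q, forall q, is_sign (dot z q)}.
  by move=> q /QP qj; rewrite dotC; exact: (rp_out rP jj' qj zj').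
have sQm : (span Q <= span (all_roots P))%VS.
  by apply: sub_span => q /QP qj; apply/mem_all_roots; exists j.
exists Q; split=> //; case: eqVneq => [_|m4]; first exact: (orth_roots_le4 oQ zn zQ).
have le : (size Q <= m)%N by rewrite -(orth_roots_dim oQ); exact: dimvS.
suff ne : size Q != m by move/eqP: ne; lia.
apply/eqP => am; case/eqP: m4; rewrite -am; apply: (orth_roots_span4 oQ zn zQ).
have /eqP -> : span Q == span (all_roots P).
  by rewrite eqEdim sQm (orth_roots_dim oQ) am leqnn.
by apply/memv_span/mem_all_roots; exists j'.
Qed.

Lemma several_pillars_bound k l x y : k != l -> x \in P k -> y \in P l ->
  let m := \dim (span (all_roots P)) in
  (m = 2%N /\ forall j, (size (P j) <= 2)%N) \/
  (m = 3%N /\ forall j, (size (P j) <= 4)%N) \/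
  (m = 4%N /\ forall j, (size (P j) <= 8)%N).
Proof.
move=> kl xk yl m; have H := pillar_size kl xk yl; rewrite /= -/m in H.
have m4 : (m <= 4)%N := several_pillars_dim kl xk yl.
have Pk : (0 < size (P k))%N by case: (P k) xk.
have [a [_ _ h1 _]] := H k; case: ifPn => h2 h3.
  right; right; split=> [|j]; first exact/eqP.
  by have [b [_ _ g1 _]] := H j; rewrite h2; lia.
have : (m = 2 \/ m = 3)%N by move/eqP: h2; lia.
case=> [m2|m3]; [left|right; left]; split=> // j;
  by have [b [_ _ g1 _]] := H j; rewrite ?m2 ?m3 /=; lia.
Qed.

Lemma single_pillar k : (forall l, l != k -> P l = [::]) ->
  let m := \dim (span (all_roots P)) in
  (size (P k) <= 2 * m)%N /\
  (size (P k) = (2 * m)%N -> exists Q, [/\ orth_roots Q, size Q = m &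
    {in Q, forall q, q \in P k /\ - q \in P k}]).
Proof.
move=> Pl m; have [Q [oQ QP PQ sQ sE]] := pillar_representatives k.
have mQ : size Q = m.
  rewrite -(orth_roots_dim oQ); congr (\dim _); apply/eqP; rewrite eqEsubv.
  apply/andP; split.
    by apply: sub_span => q /QP qj; apply/mem_all_roots; exists k.
  apply/span_subvP => z /mem_all_roots[j zj]; apply/mem_pm_span/PQ.
  by have [<-//|/Pl e] := eqVneq j k; rewrite e in zj.
rewrite -mQ; split=> // sz; exists Q; split=> // q qQ; split; first exact: QP.
exact: sE.
Qed.

End Several.
End Roots.

(** * The extremal configurations *)

Ltac vec_pure := apply/rowP => ?; rewrite !mxE; clear; lra.

Section OnePillar.
Context {R : realType} {d : nat}.
Implicit Types (u v w x y z q g : 'rV[R]_d) (s t L Q : seq 'rV[R]_d).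
Implicit Types (h : 'I_3 -> 'rV[R]_d) (P : 'I_3 -> seq 'rV[R]_d).

(** Then the sums [f i + f j] have norm 3, and two of them have product 1 or -1
    according as the pairs of indices meet or not: they model L(K_n). *)
Definition simplex n (f : 'I_n -> 'rV[R]_d) : Prop :=
  forall i j, dot (f i) (f j) = 2 * (i == j)%:R - 4^-1.

Definition orthonormal_family n (g : 'I_n -> 'rV[R]_d) : Prop :=
  forall i j, dot (g i) (g j) = (i == j)%:R.

Lemma is_sign1 : is_sign (1 : R). Proof. by left. Qed.
Lemma is_signN1 : is_sign (-1 : R). Proof. by right. Qed.
Lemma is_signM (a b : R) : is_sign a -> is_sign b -> is_sign (a * b).
Proof.
by case=> -> [] ->; rewrite ?mulr1 ?mul1r ?mulrN1 ?opprK; [left|right|right|left].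
Qed.
Hint Resolve is_sign1 is_signN1 is_signM : core.

Lemma mem_pm_eq s x y : mem_pm s x -> x = y -> mem_pm s y.
Proof. by move=> ? <-. Qed.

Section Decomposed.
Variables (s : seq 'rV[R]_d) (h : 'I_3 -> 'rV[R]_d) (P : 'I_3 -> seq 'rV[R]_d).
Hypothesis D : decomposition s h P.
Let rP := dec_roots D.

Lemma dec_pm k x (a b : R) : x \in P k -> - x \in P k ->
  is_sign a -> is_sign b -> mem_pm s (a *: h k + b *: x).
Proof.
move=> xk xk' sa sb.
have H : mem_pm s (h k + (a * b) *: x).
  by case: (is_signM sa sb) => ->; rewrite ?scale1r ?scaleN1r; exact: (dec_mem D).
apply: mem_pm_eq (mem_pm_sign sa H) _.
by rewrite scalerDr scalerA; case: sa => ->; rewrite ?mul1r ?mulN1r ?opprK // mulN1r.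
Qed.

Lemma dec_base_perm k l m (a b c : R) : k != l -> k != m -> l != m ->
  is_sign a -> is_sign b -> is_sign c ->
  mem_pm s (a *: h k + b *: h l + c *: h m).
Proof.
move=> kl km lm sa sb sc; move: kl km lm.
case: (I3P k) => ->; case: (I3P l) => ->; case: (I3P m) => -> // _ _ _.
- exact: (dec_base D).
- by apply: mem_pm_eq (dec_base D sa sc sb) _; vec_lra.
- by apply: mem_pm_eq (dec_base D sb sa sc) _; vec_lra.
- by apply: mem_pm_eq (dec_base D sc sa sb) _; vec_lra.
- by apply: mem_pm_eq (dec_base D sb sc sa) _; vec_lra.
- by apply: mem_pm_eq (dec_base D sc sb sa) _; vec_lra.
Qed.

(** The signed sums of the frame are [h k] and [- h k] plus or minus the roots
    [h k1 + h k2] and [h k1 - h k2], which are orthogonal to the pillar [k]. So the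
    four lines that are in no pillar look like two more pairs in the pillar [k]. *)
Lemma single_pillar_frame k : (forall l, l != k -> P l = [::]) ->
  let m := \dim (span (all_roots P)) in size (P k) = (2 * m)%N ->
  exists (h0 : 'rV[R]_d) (q : 'I_(m + 2) -> 'rV[R]_d),
    [/\ dot h0 h0 = 1, forall i, dot h0 (q i) = 0,
        forall i j, dot (q i) (q j) = 2 * (i == j)%:R &
        forall i, mem_pm s (h0 + q i) /\ mem_pm s (- h0 + q i)].
Proof.
move=> Pl m sk; have [Q [oQ sQ QP]] := (single_pillar rP Pl).2 sk.
have [k1 [k2 [kk1 kk2 k12]]] : exists k1 k2 : 'I_3, [/\ k != k1, k != k2 & k1 != k2].
  by case: (I3P k) => ->; [exists i1, i2|exists i0, i2|exists i0, i1].
pose T := [:: h k1 + h k2, h k1 - h k2 & Q].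
have sT : size T = (m + 2)%N by rewrite /= sQ addn2.
have hh := dec_h D.
have hQ l x : x \in Q -> dot x (h l) = 0 by move=> /QP[+ _]; exact: (dec_orth D).
have hQ' l x : x \in Q -> dot (h l) x = 0 by rewrite dotC; exact: hQ.
have [kk1' kk2' k12'] : [/\ k1 != k, k2 != k & k2 != k1] by rewrite !(eq_sym k2) eq_sym.
have nT : {in T, forall x, [/\ dot x x = 2, dot (h k) x = 0,
    mem_pm s (h k + x) & mem_pm s (- h k + x)]}.
  move=> x; rewrite !inE => /or3P[/eqP ->|/eqP ->|xQ].
  - split; rewrite ?dotE ?hh ?eqxx ?(negPf kk1) ?(negPf kk2) ?(negPf k12)
        ?(negPf k12') /=; try scalar_lra.
      apply: mem_pm_eq (dec_base_perm kk1 kk2 k12 is_sign1 is_sign1 is_sign1) _; vec_lra.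
    apply: mem_pm_eq (dec_base_perm kk1 kk2 k12 is_signN1 is_sign1 is_sign1) _; vec_lra.
  - split; rewrite ?dotE ?hh ?eqxx ?(negPf kk1) ?(negPf kk2) ?(negPf k12)
        ?(negPf k12') /=; try scalar_lra.
      apply: mem_pm_eq (dec_base_perm kk1 kk2 k12 is_sign1 is_sign1 is_signN1) _; vec_lra.
    apply: mem_pm_eq (dec_base_perm kk1 kk2 k12 is_signN1 is_sign1 is_signN1) _; vec_lra.
  - have [xk xk'] := QP x xQ; split; first exact: (or_norm oQ).
    + exact: hQ'.
    + exact: (dec_mem D).
    + by apply: mem_pm_eq (dec_pm xk xk' is_signN1 is_sign1) _; vec_lra.
have oT : {in T &, forall x y, x != y -> dot x y = 0}.
  move=> x y; rewrite !inE => /or3P[/eqP ->|/eqP ->|xQ] /or3P[/eqP ->|/eqP ->|yQ];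
    rewrite ?eqxx // ?dotE ?hh ?eqxx ?(negPf k12) ?(negPf k12') /=
      ?hQ ?hQ' //=; try scalar_lra.
  exact: (or_orth oQ).
have uT : uniq T.
  have hk1 x : x \in Q -> h k1 + h k2 <> x /\ h k1 - h k2 <> x.
    move=> xQ; split=> e; have := hQ k1 _ xQ; rewrite -e !dotE !hh eqxx
      ?(negPf k12) ?(negPf k12') /= => h0; move: h0; scalar_lra.
  rewrite /T /= !inE negb_or (or_uniq oQ) andbT; apply/andP; split; [apply/andP; split|].
  - apply/eqP => e; have : dot (h k1 + h k2) (h k2) = dot (h k1 - h k2) (h k2) by rewrite e.
    by rewrite !dotE !hh eqxx (negPf k12) /= => h0; move: h0; scalar_lra.
  - by apply/negP => /hk1[].
  - by apply/negP => /hk1[].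
exists (h k), (fun i => T`_i).
have Ti (i : 'I_(m + 2)) : T`_i \in T by rewrite mem_nth ?sT.
split.
- by rewrite hh eqxx.
- by move=> i; have [] := nT _ (Ti i).
- move=> i j; have [<-|ne] := eqVneq i j.
    by have [-> _ _ _] := nT _ (Ti i); rewrite /=; scalar_lra.
  by rewrite oT ?mulr0// nth_uniq ?sT.
- by move=> i; have [] := nT _ (Ti i).
Qed.

Section Several.
Variables (k l : 'I_3) (x0 y0 : 'rV[R]_d).
Hypotheses (kl : k != l) (x0k : x0 \in P k) (y0l : y0 \in P l).
Let m := \dim (span (all_roots P)).

Lemma full_pillar j c : size (P j) = (2 * c)%N ->
  c = (if m == 4 then 4 else m.-1)%N ->
  exists Q, [/\ orth_roots Q, {subset Q <= P j}, size Q = c &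
    {in Q, forall x, - x \in P j}].
Proof.
move=> sj ce; have [Q [oQ QP sQ sE]] := pillar_size rP kl x0k y0l j.
rewrite -/m -ce => le.
have sQc : size Q = c by lia.
by exists Q; split=> //; apply: sE; rewrite sQc.
Qed.

End Several.
End Decomposed.

(** The simplex consists of [p + g1], [p - g1], [p' + g2], [p' - g2] and [p'']. *)
Lemma simplex5_of_gram s p p' p'' g1 g2 :
  [/\ dot p p = 3 / 4, dot p' p' = 3 / 4, dot p'' p'' = 7 / 4,
    dot p p' = - 4^-1 & dot p p'' = - 4^-1 /\ dot p' p'' = - 4^-1] ->
  [/\ dot g1 p = 0, dot g1 p' = 0 & dot g1 p'' = 0] ->
  [/\ dot g2 p = 0, dot g2 p' = 0 & dot g2 p'' = 0] ->
  [/\ dot g1 g1 = 1, dot g2 g2 = 1 & dot g1 g2 = 0] ->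
  exists f : 'I_5 -> 'rV[R]_d, simplex f /\
    (mem_pm s (p + p) -> mem_pm s (p' + p') ->
     (forall a b, is_sign a -> is_sign b -> mem_pm s (p + p' + a *: g1 + b *: g2)) ->
     (forall a, is_sign a -> mem_pm s (p + p'' + a *: g1)) ->
     (forall a, is_sign a -> mem_pm s (p' + p'' + a *: g2)) ->
     forall i j, i != j -> mem_pm s (f i + f j)).
Proof.
move=> [pp pp' pp'' d1 [d2 d3]] [a1 a2 a3] [b1 b2 b3] [g11 g22 g12].
pose F := [:: p + g1; p - g1; p' + g2; p' - g2; p''].
exists (fun i => F`_i); split.
  move=> i j; wlog le_ij : i j / (i <= j)%N.
    move=> W; case/orP: (leq_total i j) => ij; first exact: W.
    by rewrite dotC eq_sym; exact: W.
  rewrite -val_eqE.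
  case: i j le_ij => [[|[|[|[|[|//]]]]] ?] [[|[|[|[|[|//]]]]] ?] //= _;
    rewrite ?dotE ?(dotC p g1) ?(dotC p g2) ?(dotC p' g1) ?(dotC p' g2) ?(dotC g2 g1)
      ?pp ?pp' ?pp'' ?d1 ?d2 ?d3 ?a1 ?a2 ?a3 ?b1 ?b2 ?b3 ?g11 ?g22 ?g12; clear; lra.
move=> mp mp' mg1g2 m1 m2.
have W (i j : 'I_5) : (i < j)%N -> mem_pm s (F`_i + F`_j).
  case: i j => [[|[|[|[|[|//]]]]] ?] [[|[|[|[|[|//]]]]] ?] //= _.
  - by apply: mem_pm_eq mp _; vec_pure.
  - by apply: mem_pm_eq (mg1g2 1 1 _ _) _ => //; vec_pure.
  - by apply: mem_pm_eq (mg1g2 1 (-1) _ _) _ => //; vec_pure.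
  - by apply: mem_pm_eq (m1 1 _) _ => //; vec_pure.
  - by apply: mem_pm_eq (mg1g2 (-1) 1 _ _) _ => //; vec_pure.
  - by apply: mem_pm_eq (mg1g2 (-1) (-1) _ _) _ => //; vec_pure.
  - by apply: mem_pm_eq (m1 (-1) _) _ => //; vec_pure.
  - by apply: mem_pm_eq mp' _; vec_pure.
  - by apply: mem_pm_eq (m2 1 _) _ => //; vec_pure.
  - by apply: mem_pm_eq (m2 (-1) _) _ => //; vec_pure.
move=> i j; rewrite neq_ltn => /orP[]; first exact: W.
by rewrite addrC; exact: W.
Qed.

(** Signs of the roots [x], [y], [z] of the three pillars can be chosen with
    [x + y + z = 0], as three independent roots do not fit into a plane. *)
Lemma simplex5_of_pillars s h P (k l : 'I_3) x0 y0 : decomposition s h P ->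
  k != l -> x0 \in P k -> y0 \in P l -> \dim (span (all_roots P)) = 2%N ->
  (forall j, size (P j) = 2%N) ->
  exists f : 'I_5 -> 'rV[R]_d, simplex f /\
    forall i j, i != j -> mem_pm s (f i + f j).
Proof.
move=> D kl x0k y0l m2 s2; have hh := dec_h D; have rP := dec_roots D.
have X j : exists x, [/\ x \in P j, - x \in P j & dot x x = 2].
  have := full_pillar D kl x0k y0l (j := j) (c := 1) (s2 j).
  rewrite m2 => /(_ erefl)[[|x [|? ?]] [oQ QP // _ QN]].
  by exists x; rewrite QP ?QN ?mem_head // (or_norm oQ) ?mem_head.
have Xneg j (a : R) x : is_sign a -> x \in P j -> - x \in P j ->
    a *: x \in P j /\ - (a *: x) \in P j.
  by case=> ->; rewrite ?scale1r ?scaleN1r ?opprK.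
have [x [xP xP' xx]] := X i0.
have X' j : j != i0 -> exists y, [/\ y \in P j, - y \in P j, dot y y = 2 & dot x y = -1].
  move=> j0; have [y [yP yP' yy]] := X j.
  have sxy : is_sign (dot x y) by apply: (rp_out rP _ xP yP); rewrite eq_sym.
  have sN : is_sign (- dot x y) by case: sxy => ->; [right|left]; rewrite ?opprK.
  have [h1 h2] := Xneg j _ y sN yP yP'.
  exists (- dot x y *: y); split=> //; rewrite !dotE ?yy; case: sxy => ->; lra.
have [y [yP yP' yy xy]] := X' i1 isT.
have [z [zP zP' zz xz]] := X' i2 isT.
have yz : dot y z = -1.
  case: (rp_out rP (k := i1) (l := i2) isT yP zP) => // yz; exfalso.
  have xny : x != y by apply/eqP => e; move: xy; rewrite -e xx; scalar_lra.
  have xnz : x != z by apply/eqP => e; move: xz; rewrite -e xx; scalar_lra.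
  have ynz : y != z by apply/eqP => e; move: yz; rewrite -e yy; scalar_lra.
  have fr : free [:: x; y; z].
    (* Changing the sign of [x] makes all products 1. *)
    apply: (@free_gram _ _ _ (fun u => if u == x then -1 else 1) 1 1).
    - by rewrite /= !inE negb_or xny xnz ynz.
    - exact: oner_neq0.
    - by rewrite /= mulr1 -natr1 -natr1 -natr1; apply/eqP; scalar_lra.
    - by move=> u _; case: ifP => _; rewrite ?oppr_eq0 oner_neq0.
    - move=> u v; rewrite !inE => /or3P[] /eqP -> /or3P[] /eqP ->;
      rewrite ?eqxx ?[y == x]eq_sym ?[z == x]eq_sym ?[z == y]eq_sym
         ?(negPf xny) ?(negPf xnz) ?(negPf ynz) ?(dotC y x) ?(dotC z x) ?(dotC z y)
         ?xx ?yy ?zz ?xy ?xz ?yz /=; scalar_lra.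
  have : (\dim (span [:: x; y; z]) <= \dim (span (all_roots P)))%N.
    apply/dimvS/sub_span => u; rewrite !inE => /or3P[] /eqP ->; apply/mem_all_roots.
    - by exists i0.
    - by exists i1.
    - by exists i2.
  by rewrite (eqP fr) m2.
have zE : z = - (x + y).
  apply: (dot_eq_opp (c := 2)) => //.
    by rewrite !dotE (dotC y x) xx yy xy; lra.
  by rewrite !dotE (dotC z x) (dotC z y) xz yz; lra.
have Bx a b : is_sign a -> is_sign b -> mem_pm s (a *: h i0 + b *: x) by exact: (dec_pm D).
have By a b : is_sign a -> is_sign b -> mem_pm s (a *: h i1 + b *: y) by exact: (dec_pm D).
have Bz a b : is_sign a -> is_sign b -> mem_pm s (a *: h i2 + b *: z) by exact: (dec_pm D).
have Bh := dec_base D.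
have hx j : dot (h j) x = 0 by rewrite dotC; exact: (dec_orth D _ xP).
have hy j : dot (h j) y = 0 by rewrite dotC; exact: (dec_orth D _ yP).
have xh j : dot x (h j) = 0 by exact: (dec_orth D _ xP).
have yh j : dot y (h j) = 0 by exact: (dec_orth D _ yP).
have yx : dot y x = -1 by rewrite dotC.
pose p := 2^-1 *: (h i0 - x); pose p' := 2^-1 *: (h i0 + x).
pose p'' := 2^-1 *: (- h i0 + x) + y.
have dp : [/\ dot p p = 3 / 4, dot p' p' = 3 / 4, dot p'' p'' = 7 / 4,
    dot p p' = - 4^-1 & dot p p'' = - 4^-1 /\ dot p' p'' = - 4^-1].
  by rewrite /p /p' /p'' !dotE hh hx hy xh yh xx yy xy yx /=; split;
    try split; clear; lra.
have dh j : j != i0 -> [/\ dot (h j) p = 0, dot (h j) p' = 0 & dot (h j) p'' = 0].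
  move=> j0; rewrite /p /p' /p'' !dotE hh hx hy (negPf j0) /=.
  by split; clear; lra.
have dhh : [/\ dot (h i1) (h i1) = 1, dot (h i2) (h i2) = 1 & dot (h i1) (h i2) = 0].
  by rewrite !hh.
have [f [sf F]] := simplex5_of_gram s dp (dh i1 isT) (dh i2 isT) dhh.
exists f; split=> //; apply: F; rewrite /p /p' /p''.
- by apply: mem_pm_eq (Bx 1 (-1) _ _) _ => //; vec_pure.
- by apply: mem_pm_eq (Bx 1 1 _ _) _ => //; vec_pure.
- move=> a b sa sb.
  by apply: mem_pm_eq (Bh 1 a b _ _ _) _ => //; vec_pure.
- move=> a sa; by apply: mem_pm_eq (By a 1 _ _) _ => //; vec_pure.
- move=> a sa; apply: mem_pm_eq (Bz a (-1) _ _) _ => //; rewrite zE; vec_pure.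
Qed.

End OnePillar.

Section SeveralPillars.
Context {R : realType} {d : nat}.
Implicit Types (u v w x y z q g : 'rV[R]_d) (s t l L Q : seq 'rV[R]_d).
Implicit Types (h : 'I_3 -> 'rV[R]_d) (P : 'I_3 -> seq 'rV[R]_d).
Hint Resolve is_sign1 is_signN1 is_signM : core.

Fixpoint orthonormal_seq l : Prop :=
  if l is x :: l' then
    [/\ dot x x = 1, {in l', forall y, dot x y = 0} & orthonormal_seq l']
  else True.

Lemma orthonormal_seq_norm l x : orthonormal_seq l -> x \in l -> dot x x = 1.
Proof.
by elim: l => //= y l IH [yy _ ol]; rewrite inE => /orP[/eqP ->|/(IH ol)].
Qed.

Lemma orthonormal_seq_uniq l : orthonormal_seq l -> uniq l.
Proof.
elim: l => //= x l IH [xx xl ol]; rewrite IH// andbT; apply/negP => /xl.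
by rewrite xx => /eqP; rewrite oner_eq0.
Qed.

Lemma orthonormal_seq_dot l : orthonormal_seq l ->
  {in l &, forall x y, dot x y = (x == y)%:R}.
Proof.
elim: l => //= z l IH [zz zl ol] x y; rewrite !inE.
have zn w : w \in l -> (z == w) = false.
  move=> wl; apply/negbTE/eqP => e; move: (zl w wl).
  by rewrite -e zz => /eqP; rewrite oner_eq0.
case/orP=> [/eqP ->|xl] /orP[/eqP ->|yl].
- by rewrite zz eqxx.
- by rewrite zl // zn.
- by rewrite dotC zl // eq_sym zn.
- exact: IH.
Qed.

Lemma orthonormal_seq_cat l1 l2 : orthonormal_seq l1 -> orthonormal_seq l2 ->
  (forall x y, x \in l1 -> y \in l2 -> dot x y = 0) -> orthonormal_seq (l1 ++ l2).
Proof.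
elim: l1 => //= x l1 IH [xx xl o1] o2 o12; split=> //; last first.
  by apply: IH => // y z yl zl; rewrite o12 // inE yl orbT.
move=> y; rewrite mem_cat => /orP[/xl //|]; apply: o12; exact: mem_head.
Qed.

Lemma orthonormal_seq_free l : orthonormal_seq l -> free l.
Proof.
move=> ol; apply: (@free_gram _ _ _ (fun=> 1) 1 0).
- exact: orthonormal_seq_uniq.
- exact: oner_neq0.
- by rewrite mulr0 addr0 oner_neq0.
- by move=> *; exact: oner_neq0.
- by move=> x y xl yl; rewrite (orthonormal_seq_dot ol xl yl); ring.
Qed.

Lemma orthonormal_seq_expand l v : orthonormal_seq l -> v \in span l ->
  v = \sum_(x <- l) dot v x *: x.
Proof.
move=> ol vl; apply/eqP; rewrite -subr_eq0; apply/eqP/dot_eq0.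
apply: (orth_span (s := l)); last first.
  by rewrite memvB // big_seq memv_suml // => x xl; rewrite memvZ // memv_span.
move=> u ul; rewrite dotDr dotNr dot_sumr (bigD1_seq u) ?orthonormal_seq_uniq //=.
rewrite big_seq_cond big1 => [|x /andP[xl xu]]; rewrite dotZr.
  by rewrite (orthonormal_seq_norm ol ul) (dotC v); ring.
by rewrite (orthonormal_seq_dot ol ul xl) eq_sym (negPf xu) mulr0.
Qed.

Lemma orthonormal_seq_family l : orthonormal_seq l ->
  orthonormal_family (fun i : 'I_(size l) => l`_i).
Proof.
move=> ol i j; rewrite (orthonormal_seq_dot ol) ?mem_nth //.
by rewrite nth_uniq ?orthonormal_seq_uniq.
Qed.

Lemma orthonormal_frame h : (forall k k', dot (h k) (h k') = (k == k')%:R) ->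
  orthonormal_seq [:: h i0; h i1; h i2].
Proof.
move=> hh; rewrite /= !hh; do !split=> //; move=> y; rewrite !inE => //.
  by case/orP => /eqP ->; rewrite hh.
by move/eqP => ->; rewrite hh.
Qed.

Lemma dot_orthonormal n (u : 'I_n -> 'rV[R]_d) (a b : 'I_n -> R) :
  orthonormal_family u ->
  dot (\sum_i a i *: u i) (\sum_i b i *: u i) = \sum_i a i * b i.
Proof.
move=> ou; rewrite dot_suml; apply: eq_bigr => i _.
rewrite dotZl dot_sumr (bigD1 i)//= big1 => [|j ji].
  by rewrite dotZr ou eqxx addr0 mulr1.
by rewrite dotZr ou eq_sym (negPf ji) mulr0.
Qed.

Definition signed_pairs (x y : 'rV[R]_d) : seq 'rV[R]_d :=
  [seq a *: x + b *: y | a <- [:: 1; -1], b <- [:: 1; -1]].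

Lemma mem_signs (a : R) : is_sign a -> a \in [:: 1; -1].
Proof. by rewrite !inE => -[->|->]; rewrite eqxx ?orbT. Qed.

Lemma mem_signed_pairs x y (a b : R) : is_sign a -> is_sign b ->
  a *: x + b *: y \in signed_pairs x y.
Proof. by move=> sa sb; apply/allpairsP; exists (a, b); split=> //=; exact: mem_signs. Qed.

Lemma is_sign_sqr (a : R) : a * a = 1 -> is_sign a.
Proof.
move=> h; have /eqP : (a - 1) * (a + 1) = 0 by lra.
by rewrite mulf_eq0 => /orP[] /eqP e; [left|right]; lra.
Qed.

Lemma sign_half_even (a b g : R) : is_sign a -> is_sign b -> is_sign g ->
  [\/ (a + b) / 2 + g = 2, (a + b) / 2 + g = 0 | (a + b) / 2 + g = -2] -> b = a.
Proof. by case=> -> [] -> [] -> [] h; rewrite ?opprK //; exfalso; lra. Qed.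

Lemma sign_half_odd (a b g : R) : is_sign a -> is_sign b -> is_sign g ->
  is_sign ((a + b) / 2 + g) -> b = - a.
Proof. by case=> -> [] -> [] -> [] h; rewrite ?opprK //; exfalso; lra. Qed.

Lemma sign_half_norm (a b g : R) : is_sign a -> is_sign b ->
  (a + b) / 2 * ((a + b) / 2) + (a - b) / 2 * ((a - b) / 2) + g * g = 2 -> is_sign g.
Proof. by case=> -> [] -> h; apply: is_sign_sqr; lra. Qed.

Definition signed_triple s x y z : Prop := forall a b c : R,
  is_sign a -> is_sign b -> is_sign c -> mem_pm s (a *: x + b *: y + c *: z).

(** The four triples are the lines of a complete quadrilateral with six vertices.
    The simplex consists of [(g1 + g4 + g5) / 2] plus or minus [g2],
    [(g1 - g4 - g5) / 2] plus or minus [g3], and [(- g1 + g4 - g5) / 2] plus or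
    minus [g6]; its sum is [g1 + g4 - g5]. *)
Lemma simplex6_of_triples s g1 g2 g3 g4 g5 g6 :
  signed_triple s g1 g2 g3 -> signed_triple s g1 g4 g5 -> signed_triple s g2 g4 g6 ->
  signed_triple s g3 g5 g6 ->
  orthonormal_family (fun i : 'I_6 => [:: g1; g2; g3; g4; g5; g6]`_i) ->
  exists f : 'I_6 -> 'rV[R]_d, [/\ simplex f,
    forall i j, i != j -> mem_pm s (f i + f j) & mem_pm s (\sum_i f i)].
Proof.
move=> M123 M145 M246 M356 ou.
pose c := 2^-1 : R.
pose C := [:: [:: c; 1; 0; c; c; 0]; [:: c; -1; 0; c; c; 0];
  [:: c; 0; 1; - c; - c; 0]; [:: c; 0; -1; - c; - c; 0];
  [:: - c; 0; 0; c; - c; 1]; [:: - c; 0; 0; c; - c; -1]].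
pose f (i : 'I_6) := \sum_(a < 6) (nth [::] C i)`_a *: [:: g1; g2; g3; g4; g5; g6]`_a.
have fE i : f i = let r := nth [::] C i in r`_0 *: g1 + r`_1 *: g2 +
    r`_2 *: g3 + r`_3 *: g4 + r`_4 *: g5 + r`_5 *: g6.
  by rewrite /f !big_ord_recl big_ord0 /= addr0 !addrA.
exists f; split.
- move=> i j; rewrite (dot_orthonormal _ _ ou) !big_ord_recl big_ord0 -val_eqE /=.
  by case: i j => [[|[|[|[|[|[|//]]]]]] ?] [[|[|[|[|[|[|//]]]]]] ?];
    rewrite /= /c; clear; lra.
- have W (i j : 'I_6) : (i < j)%N -> mem_pm s (f i + f j).
    case: i j => [[|[|[|[|[|[|//]]]]]] ?] [[|[|[|[|[|[|//]]]]]] ?] //= _; rewrite !fE /= /c.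
    + by apply: mem_pm_eq (M145 1 1 1 _ _ _) _ => //; vec_pure.
    + by apply: mem_pm_eq (M123 1 1 1 _ _ _) _ => //; vec_pure.
    + by apply: mem_pm_eq (M123 1 1 (-1) _ _ _) _ => //; vec_pure.
    + by apply: mem_pm_eq (M246 1 1 1 _ _ _) _ => //; vec_pure.
    + by apply: mem_pm_eq (M246 1 1 (-1) _ _ _) _ => //; vec_pure.
    + by apply: mem_pm_eq (M123 1 (-1) 1 _ _ _) _ => //; vec_pure.
    + by apply: mem_pm_eq (M123 1 (-1) (-1) _ _ _) _ => //; vec_pure.
    + by apply: mem_pm_eq (M246 (-1) 1 1 _ _ _) _ => //; vec_pure.
    + by apply: mem_pm_eq (M246 (-1) 1 (-1) _ _ _) _ => //; vec_pure.
    + by apply: mem_pm_eq (M145 1 (-1) (-1) _ _ _) _ => //; vec_pure.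
    + by apply: mem_pm_eq (M356 1 (-1) 1 _ _ _) _ => //; vec_pure.
    + by apply: mem_pm_eq (M356 1 (-1) (-1) _ _ _) _ => //; vec_pure.
    + by apply: mem_pm_eq (M356 (-1) (-1) 1 _ _ _) _ => //; vec_pure.
    + by apply: mem_pm_eq (M356 (-1) (-1) (-1) _ _ _) _ => //; vec_pure.
    + by apply: mem_pm_eq (M145 (-1) 1 (-1) _ _ _) _ => //; vec_pure.
  move=> i j; rewrite neq_ltn => /orP[]; first exact: W.
  by rewrite addrC; exact: W.
- rewrite !big_ord_recl big_ord0 !fE /= /c.
  by apply: mem_pm_eq (M145 1 1 (-1) _ _ _) _ => //; vec_pure.
Qed.

Lemma dec_line s h P k u v : decomposition s h P ->
  (forall a b : R, is_sign a -> is_sign b -> a *: u + b *: v \in P k) ->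
  signed_triple s (h k) u v.
Proof.
move=> D H a b c sa sb sc.
have := dec_pm D (H b c sb sc) _ sa is_sign1; rewrite scale1r addrA; apply.
rewrite opprD -!scaleNr; apply: H; rewrite -mulN1r; exact: is_signM.
Qed.

Lemma dec_span_orth s h P k v : decomposition s h P ->
  v \in span (all_roots P) -> dot (h k) v = 0.
Proof.
move=> D vR; rewrite dotC; apply: orth_span vR => u /mem_all_roots[j uj].
exact: (dec_orth D _ uj).
Qed.

Lemma full_pillar_signed s h P (k l j j' : 'I_3) x0 y0 c y : decomposition s h P ->
  k != l -> x0 \in P k -> y0 \in P l ->
  let m := \dim (span (all_roots P)) in
  j != j' -> y \in P j' ->
  size (P j) = (2 * c)%N -> c = (if m == 4 then 4 else m.-1)%N ->
  exists Q, [/\ orth_roots Q, size Q = c,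
    {in Q, forall x, x \in P j /\ - x \in P j} & {in Q, forall x, dot y x = 1}].
Proof.
move=> D kl x0k y0l m jj' yj' sj ce; have rP := dec_roots D.
have [Q [oQ QP sQ QN]] := full_pillar D kl x0k y0l sj ce.
have sy : {in Q, forall q, is_sign (dot y q)}.
  by move=> q /QP qj; rewrite dotC; exact: (rp_out rP jj' qj yj').
have inj : {in Q &, injective (fun q => dot y q *: q)}.
  move=> p q pQ qQ e; apply/eqP; apply: contraT => ne.
  have := or_orth oQ pQ qQ ne.
  have : dot (dot y p *: p) (dot y q *: q) = dot (dot y q *: q) (dot y q *: q).
    by rewrite e.
  rewrite !dotE (or_norm oQ qQ); clear e.
  by case: (sy p pQ) => ->; case: (sy q qQ) => -> h1 h2; scalar_lra.
exists [seq dot y q *: q | q <- Q]; split.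
- split; first by rewrite map_inj_in_uniq ?(or_uniq oQ).
    move=> _ /mapP[q qQ ->]; rewrite !dotE (or_norm oQ qQ).
    by case: (sy q qQ) => ->; scalar_lra.
  move=> _ _ /mapP[p pQ ->] /mapP[q qQ ->] ne.
  rewrite !dotE (or_orth oQ pQ qQ) ?mulr0//.
  by apply: contra_neq ne => ->.
- by rewrite size_map.
- move=> _ /mapP[q qQ ->]; have := QN q qQ; have := QP q qQ.
  by case: (sy q qQ) => ->; rewrite ?scale1r ?scaleN1r ?opprK.
- move=> _ /mapP[q qQ ->]; rewrite !dotE.
  by case: (sy q qQ) => ->; scalar_lra.
Qed.

(** Let [a], [b] be orthogonal roots of one pillar and [y] a root of the next one
    with positive products. The half-sum [g4] and half-difference [g5] of [a] and
    [b], and [g6 = y - g4], form an orthonormal basis. Parity only allows the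
    roots [+- g4 +- g6] in the pillar of [y] and [+- g5 +- g6] in the third one,
    and by counting they all occur. *)
Lemma simplex6_of_pillars s h P (k l : 'I_3) x0 y0 : decomposition s h P ->
  k != l -> x0 \in P k -> y0 \in P l -> \dim (span (all_roots P)) = 3%N ->
  (forall j, size (P j) = 4%N) ->
  exists f : 'I_6 -> 'rV[R]_d, [/\ simplex f,
    forall i j, i != j -> mem_pm s (f i + f j) & mem_pm s (\sum_i f i)].
Proof.
move=> D kl x0k y0l m3 s4.
have hh := dec_h D; have oP := dec_orth D; have rP := dec_roots D.
have [y yP] : exists y, y \in P i1.
  by case: (P i1) (s4 i1) => // y t _; exists y; rewrite mem_head.
have := @full_pillar_signed s h P k l i0 i1 x0 y0 2 y D kl x0k y0l isT yP (s4 i0).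
rewrite m3 => /(_ erefl)[Q [oQ sQ QP yQ]].
case: Q oQ sQ QP yQ => [|a [|b []]] // oQ _ QP yQ.
have ma : a \in [:: a; b] by rewrite mem_head.
have mb : b \in [:: a; b] by rewrite !inE eqxx orbT.
have [aP aP'] := QP a ma; have [bP bP'] := QP b mb.
have ya := yQ a ma; have yb := yQ b mb.
have aa := or_norm oQ ma; have bb := or_norm oQ mb.
have ab : dot a b = 0.
  by apply: (or_orth oQ) => //; have := or_uniq oQ; rewrite /= inE andbT.
have yy := rp_norm rP yP.
pose g4 := 2^-1 *: (a + b); pose g5 := 2^-1 *: (a - b); pose g6 := y - g4.
have og : orthonormal_seq [:: g4; g5; g6].
  rewrite /= /g6 /g4 /g5; split; last split; last split=> //.
  - by rewrite !dotE (dotC b a) aa bb ab; clear; lra.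
  - move=> z; rewrite !inE => /orP[] /eqP ->; rewrite !dotE ?(dotC b a)
      ?(dotC a y) ?(dotC b y) ?aa ?bb ?ab ?ya ?yb; clear; lra.
  - by rewrite !dotE (dotC b a) aa bb ab; clear; lra.
  - move=> z; rewrite !inE => /eqP ->; rewrite !dotE ?(dotC b a)
      ?(dotC a y) ?(dotC b y) ?aa ?bb ?ab ?ya ?yb; clear; lra.
  - by rewrite !dotE (dotC b a) ?(dotC a y) ?(dotC b y) aa bb ab ya yb yy; clear; lra.
have inR j x : x \in P j -> x \in span (all_roots P).
  by move=> xj; apply/memv_span/mem_all_roots; exists j.
have [g4R g5R] : g4 \in span (all_roots P) /\ g5 \in span (all_roots P).
  by split; [apply/memvZ/memvD|apply/memvZ/memvB]; apply: (inR i0).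
have g6R : g6 \in span (all_roots P) by apply: memvB => //; apply: (inR i1).
have [aE bE yE] : [/\ a = g4 + g5, b = g4 - g5 & y = g4 + g6].
  by split; rewrite /g6 /g4 /g5; vec_pure.
clearbody g4 g5 g6.
have GR : span [:: g4; g5; g6] = span (all_roots P).
  apply/eqP; rewrite eqEdim (eqP (orthonormal_seq_free og)) m3 /= andbT.
  by apply/span_subvP => u; rewrite !inE => /or3P[] /eqP ->.
have expand j v : v \in P j ->
    v = dot v g4 *: g4 + dot v g5 *: g5 + dot v g6 *: g6.
  move=> /inR; rewrite -GR => /(orthonormal_seq_expand og) {1}->.
  by rewrite !big_cons big_nil addr0 !addrA.
have coords j v : j != i0 -> v \in P j ->
    exists al be ga, [/\ is_sign al, is_sign be, is_sign ga,
      v = ((al + be) / 2) *: g4 + ((al - be) / 2) *: g5 + ga *: g6 &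
      dot v y = (al + be) / 2 + ga].
  move=> j0 vj; exists (dot v a), (dot v b), (dot v g6).
  have sa : is_sign (dot v a) by exact: (rp_out rP j0 vj aP).
  have sb : is_sign (dot v b) by exact: (rp_out rP j0 vj bP).
  have d4 : dot v g4 = (dot v a + dot v b) / 2.
    by rewrite aE bE !dotE; clear; lra.
  have d5 : dot v g5 = (dot v a - dot v b) / 2.
    by rewrite aE bE !dotE; clear; lra.
  have vE := expand _ _ vj.
  split=> //; last by rewrite -d4 yE !dotE.
    apply: (sign_half_norm sa sb); rewrite -d4 -d5 -(rp_norm rP vj).
    by rewrite [X in _ = dot X _]vE !dotE !(dotC _ v).
  by rewrite -d4 -d5.
have sub1 : {subset P i1 <= signed_pairs g4 g6}.
  move=> v vP; have [al [be [ga [sa sb sg vE dy]]]] := coords i1 v isT vP.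
  have e1 : be = al.
    apply: (sign_half_even sa sb sg); rewrite -dy.
    have [->|ne] := eqVneq v y; first by constructor 1.
    by case: (rp_in rP vP yP ne); [constructor 2|constructor 3].
  have -> : v = al *: g4 + ga *: g6 by rewrite vE e1; vec_pure.
  exact: mem_signed_pairs.
have sub2 : {subset P i2 <= signed_pairs g5 g6}.
  move=> v vP; have [al [be [ga [sa sb sg vE dy]]]] := coords i2 v isT vP.
  have e1 : be = - al.
    apply: (sign_half_odd sa sb sg); rewrite -dy.
    exact: (rp_out rP (k := i2) (l := i1) isT vP yP).
  have -> : v = al *: g5 + ga *: g6 by rewrite vE e1; vec_pure.
  exact: mem_signed_pairs.
have eq1 : P i1 =i signed_pairs g4 g6.
  by apply: (uniq_min_size (rp_uniq rP i1) sub1 _).2; rewrite s4.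
have eq2 : P i2 =i signed_pairs g5 g6.
  by apply: (uniq_min_size (rp_uniq rP i2) sub2 _).2; rewrite s4.
have M246 : signed_triple s (h i1) g4 g6.
  by apply: (dec_line D) => *; rewrite eq1; exact: mem_signed_pairs.
have M356 : signed_triple s (h i2) g5 g6.
  by apply: (dec_line D) => *; rewrite eq2; exact: mem_signed_pairs.
have eqP0 u v : u \in P i0 -> u = v -> v \in P i0 by move=> ? <-.
have M145 : signed_triple s (h i0) g4 g5.
  apply: (dec_line D) => e1 e2 [] -> [] ->.
  - by apply: eqP0 aP _; rewrite aE; vec_pure.
  - by apply: eqP0 bP _; rewrite bE; vec_pure.
  - by apply: eqP0 bP' _; rewrite bE; vec_pure.
  - by apply: eqP0 aP' _; rewrite aE; vec_pure.
apply: (simplex6_of_triples (dec_base D) M145 M246 M356).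
apply: (@orthonormal_seq_family [:: h i0; h i1; h i2; g4; g5; g6]).
apply: (orthonormal_seq_cat (orthonormal_frame hh) og) => u v.
rewrite !inE => /or3P[] /eqP -> /or3P[] /eqP ->; exact: (dec_span_orth _ D).
Qed.

End SeveralPillars.

Section FullRootSystem.
Context {R : realType} {d : nat}.
Implicit Types (u v w x y z q g : 'rV[R]_d) (s t L Q : seq 'rV[R]_d).
Implicit Types (h : 'I_3 -> 'rV[R]_d) (P : 'I_3 -> seq 'rV[R]_d).
Hint Resolve is_sign1 is_signN1 is_signM : core.

Definition bits (i : nat) : bool * bool * bool :=
  (odd i, odd i./2, odd i./2./2).

Lemma bits_inj (i j : 'I_8) : bits i = bits j -> i = j.
Proof.
case: i j => [[|[|[|[|[|[|[|[|//]]]]]]]] hi] [[|[|[|[|[|[|[|[|//]]]]]]]] hj] //= _;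
  exact: val_inj.
Qed.

Section Hadamard.
Variables (s : seq 'rV[R]_d) (g1 g2 g3 g4 g5 g6 g7 : 'rV[R]_d).

Hypotheses (M123 : signed_triple s g1 g2 g3) (M145 : signed_triple s g1 g4 g5)
  (M167 : signed_triple s g1 g6 g7) (M246 : signed_triple s g2 g4 g6)
  (M257 : signed_triple s g2 g5 g7) (M347 : signed_triple s g3 g4 g7)
  (M356 : signed_triple s g3 g5 g6).

Let u (i : 'I_7) := [:: g1; g2; g3; g4; g5; g6; g7]`_i.

Hypothesis ou : orthonormal_family u.

(** The seven nontrivial characters of (Z/2)^3 at the point with signs [x], [y], [z]. *)
Definition chi (x y z : R) (i : 'I_7) : R :=
  [:: x; y; x * y; z; x * z; y * z; x * y * z]`_i.

(** Half a row of a Hadamard matrix of order 8, without its constant column. *)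
Definition hadamard (x y z : R) : 'rV[R]_d :=
  \sum_i (chi x y z i / 2) *: u i.

Definition bit_sign (b : bool) : R := if b then -1 else 1.

Definition hadamard_simplex (i : 'I_8) : 'rV[R]_d :=
  let: (x, y, z) := bits i in
  hadamard (bit_sign x) (bit_sign y) (bit_sign z).

Lemma is_sign_bit b : is_sign (bit_sign b).
Proof. by case: b; [right|left]. Qed.

Lemma hadamard_dot (x y z x' y' z' : R) :
  dot (hadamard x y z) (hadamard x' y' z') =
  (x * x' + y * y' + x * y * (x' * y') + z * z' + x * z * (x' * z') +
   y * z * (y' * z') + x * y * z * (x' * y' * z')) / 4.
Proof.
rewrite dot_orthonormal// !big_ord_recl big_ord0 /chi /=; lra.
Qed.

Lemma hadamard_simplexP : simplex hadamard_simplex.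
Proof.
move=> i j; have [<-|ne] := eqVneq i j.
  rewrite /hadamard_simplex; case: (bits i) => [[x y] z]; rewrite hadamard_dot.
  by case: x; case: y; case: z; rewrite /bit_sign /=; lra.
have : bits i != bits j by apply: contra_neq ne => /bits_inj.
rewrite /hadamard_simplex; case: (bits i) (bits j) => [[x y] z] [[x' y'] z'].
rewrite hadamard_dot.
by case: x; case: y; case: z; case: x'; case: y'; case: z' => // _;
  rewrite /bit_sign /=; lra.
Qed.

(** In the sum of two rows the four characters that separate the two points cancel,
    and the other three form a line of the Fano plane. *)
Lemma hadamard_mem (x y z x' y' z' : R) : is_sign x -> is_sign y -> is_sign z ->
  x' = x \/ x' = - x -> y' = y \/ y' = - y -> z' = z \/ z' = - z ->
  [|| x' == - x, y' == - y | z' == - z] ->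
  mem_pm s (hadamard x y z + hadamard x' y' z').
Proof.
move=> sx sy sz; have nz (a : R) : is_sign a -> (a == - a) = false.
  by case=> ->; apply/negbTE/eqP; lra.
have F (a b c : R) : hadamard a b c = (a / 2) *: g1 + (b / 2) *: g2 + (a * b / 2) *: g3 +
   (c / 2) *: g4 + (a * c / 2) *: g5 + (b * c / 2) *: g6 + (a * b * c / 2) *: g7.
  by rewrite /hadamard !big_ord_recl big_ord0 /chi /u /= addr0 !addrA.
rewrite !F => -[->|->] [->|->] [->|->]; rewrite ?nz ?eqxx //= => _.
- by apply: mem_pm_eq (M123 sx sy (is_signM sx sy)) _; apply/rowP => ?; rewrite !mxE; lra.
- by apply: mem_pm_eq (M145 sx sz (is_signM sx sz)) _; apply/rowP => ?; rewrite !mxE; lra.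
- by apply: mem_pm_eq (M167 sx (is_signM sy sz) (is_signM (is_signM sx sy) sz)) _;
    apply/rowP => ?; rewrite !mxE; lra.
- by apply: mem_pm_eq (M246 sy sz (is_signM sy sz)) _; apply/rowP => ?; rewrite !mxE; lra.
- by apply: mem_pm_eq (M257 sy (is_signM sx sz) (is_signM (is_signM sx sy) sz)) _;
    apply/rowP => ?; rewrite !mxE; lra.
- by apply: mem_pm_eq (M347 (is_signM sx sy) sz (is_signM (is_signM sx sy) sz)) _;
    apply/rowP => ?; rewrite !mxE; lra.
- by apply: mem_pm_eq (M356 (is_signM sx sy) (is_signM sx sz) (is_signM sy sz)) _;
    apply/rowP => ?; rewrite !mxE; lra.
Qed.

Lemma hadamard_simplex_mem i j : i != j ->
  mem_pm s (hadamard_simplex i + hadamard_simplex j).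
Proof.
move=> ne; have : bits i != bits j by apply: contra_neq ne => /bits_inj.
rewrite /hadamard_simplex; case: (bits i) (bits j) => [[x y] z] [[x' y'] z'] ne'.
have cmp a b : bit_sign b = bit_sign a \/ bit_sign b = - bit_sign a.
  by case: a; case: b; rewrite /bit_sign ?opprK; auto.
apply: hadamard_mem; try exact: is_sign_bit; try exact: cmp.
by move: ne'; case: x; case: y; case: z; case: x'; case: y'; case: z';
  rewrite /bit_sign ?opprK ?eqxx ?orbT.
Qed.

End Hadamard.

Lemma four_signs_even (a1 a2 a3 a4 : R) :
  is_sign a1 -> is_sign a2 -> is_sign a3 -> is_sign a4 ->
  [\/ (a1 + a2 + a3 + a4) / 2 = 2, (a1 + a2 + a3 + a4) / 2 = 0 |
      (a1 + a2 + a3 + a4) / 2 = -2] ->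
  a2 = a1 /\ a4 = a3 \/ a2 = - a1 /\ a4 = - a3.
Proof.
by case=> -> [] -> [] -> [] -> [] h;
  first [by left | by right; rewrite ?opprK | exfalso; lra].
Qed.

Lemma four_signs_odd (a1 a2 a3 a4 : R) :
  is_sign a1 -> is_sign a2 -> is_sign a3 -> is_sign a4 ->
  is_sign ((a1 + a2 + a3 + a4) / 2) ->
  a2 = a1 /\ a4 = - a3 \/ a2 = - a1 /\ a4 = a3.
Proof.
by case=> -> [] -> [] -> [] -> [] h;
  first [by left; rewrite ?opprK | by right; rewrite ?opprK | exfalso; lra].
Qed.

(** The orthogonal roots [a], [b], [c], [e] of one pillar are a basis in which the
    roots of the others are half-sums with signs. With [y] as the half-sum without
    signs, the pillar of [y] only contains even numbers of minus signs and the
    third pillar only odd ones, and by counting all of these occur. In the basis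
    of half-sums and half-differences of [a], [b] and of [c], [e], all lines are
    signed sums over the lines of the Fano plane. *)
Lemma simplex8_of_pillars s h P (k l : 'I_3) x0 y0 : decomposition s h P ->
  k != l -> x0 \in P k -> y0 \in P l -> \dim (span (all_roots P)) = 4%N ->
  (forall j, size (P j) = 8%N) ->
  exists f : 'I_8 -> 'rV[R]_d, simplex f /\
    forall i j, i != j -> mem_pm s (f i + f j).
Proof.
move=> D kl x0k y0l m4 s8.
have hh := dec_h D; have oP := dec_orth D; have rP := dec_roots D.
have [y yP] : exists y, y \in P i1.
  by case: (P i1) (s8 i1) => // y t _; exists y; rewrite mem_head.
have := @full_pillar_signed _ _ s h P k l i0 i1 x0 y0 4 y D kl x0k y0l isT yP (s8 i0).
rewrite m4 => /(_ erefl)[Q [oQ sQ QP yQ]].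
have sgn j v : j != i0 -> v \in P j -> {in Q, forall q, is_sign (dot v q)}.
  by move=> j0 vj q /QP[qP _]; exact: (rp_out rP j0 vj qP).
have vproj j v : j != i0 -> v \in P j -> v = root_proj Q v.
  by move=> j0 vj; apply: (orth_roots4_span oQ (rp_norm rP vj) (sgn _ _ j0 vj)).
case: Q oQ sQ QP yQ sgn vproj => [|a [|b [|c [|e []]]]] // oQ _ QP yQ sgn vproj.
have ma : a \in [:: a; b; c; e] by rewrite !inE eqxx ?orbT.
have mb : b \in [:: a; b; c; e] by rewrite !inE eqxx ?orbT.
have mc : c \in [:: a; b; c; e] by rewrite !inE eqxx ?orbT.
have me : e \in [:: a; b; c; e] by rewrite !inE eqxx ?orbT.
have [aP aP'] := QP a ma; have [bP bP'] := QP b mb.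
have [cP cP'] := QP c mc; have [eP eP'] := QP e me.
have aa := or_norm oQ ma; have bb := or_norm oQ mb.
have cc := or_norm oQ mc; have ee := or_norm oQ me.
have /and5P[] := or_uniq oQ; rewrite !inE !negb_or.
move=> /and3P[nab nac nae] /andP[nbc nbe] nce _ _.
have ab := or_orth oQ ma mb nab; have ac := or_orth oQ ma mc nac.
have ae := or_orth oQ ma me nae; have bc := or_orth oQ mb mc nbc.
have be := or_orth oQ mb me nbe; have ce := or_orth oQ mc me nce.
have yE : y = 2^-1 *: (a + b + c + e).
  rewrite (vproj i1 y isT yP) /root_proj !big_cons big_nil
    !(yQ a ma, yQ b mb, yQ c mc, yQ e me).
  by vec_pure.
have expand j v : j != i0 -> v \in P j -> exists a1 a2 a3 a4,
    [/\ is_sign a1 /\ is_sign a2, is_sign a3 /\ is_sign a4,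
     v = 2^-1 *: (a1 *: a + a2 *: b + a3 *: c + a4 *: e) &
     dot v y = (a1 + a2 + a3 + a4) / 2].
  move=> j0 vj; exists (dot v a), (dot v b), (dot v c), (dot v e).
  have S := sgn j v j0 vj; split; try by split; apply: S.
    by rewrite {1}(vproj j v j0 vj) /root_proj !big_cons big_nil; vec_pure.
  by rewrite yE !dotE; clear; lra.
pose g4 := 2^-1 *: (a + b); pose g5 := 2^-1 *: (a - b).
pose g6 := 2^-1 *: (c + e); pose g7 := 2^-1 *: (c - e).
have yy := rp_norm rP yP.
pose E1 := signed_pairs g4 g6 ++ signed_pairs g5 g7.
pose E2 := signed_pairs g4 g7 ++ signed_pairs g5 g6.
have eqm u v (t : seq 'rV[R]_d) : u \in t -> v = u -> v \in t by move=> ? ->.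
have sub1 : {subset P i1 <= E1}.
  move=> v vP; have [a1 [a2 [a3 [a4 [[s1 s2] [s3 s4] vE dy]]]]] := expand i1 v isT vP.
  (* A product with [y] is half the sum of the four signs. *)
  have := four_signs_even s1 s2 s3 s4; rewrite -dy.
  have vy : [\/ dot v y = 2, dot v y = 0 | dot v y = -2].
    have [->|ne] := eqVneq v y; first by constructor 1.
    by case: (rp_in rP vP yP ne); [constructor 2|constructor 3].
  case/(_ vy) => -[e1 e2].
  + rewrite mem_cat (eqm _ _ _ (mem_signed_pairs g4 g6 s1 s3)) //.
    by rewrite vE e1 e2 /g4 /g6; vec_pure.
  + rewrite mem_cat orbC (eqm _ _ _ (mem_signed_pairs g5 g7 s1 s3)) //.
    by rewrite vE e1 e2 /g5 /g7; vec_pure.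
have sub2 : {subset P i2 <= E2}.
  move=> v vP; have [a1 [a2 [a3 [a4 [[s1 s2] [s3 s4] vE dy]]]]] := expand i2 v isT vP.
  have := four_signs_odd s1 s2 s3 s4; rewrite -dy.
  case/(_ (rp_out rP (k := i2) (l := i1) isT vP yP)) => -[e1 e2].
  + rewrite mem_cat (eqm _ _ _ (mem_signed_pairs g4 g7 s1 s3)) //.
    by rewrite vE e1 e2 /g4 /g7; vec_pure.
  + rewrite mem_cat orbC (eqm _ _ _ (mem_signed_pairs g5 g6 s1 s3)) //.
    by rewrite vE e1 e2 /g5 /g6; vec_pure.
have eq1 : P i1 =i E1 by apply: (uniq_min_size (rp_uniq rP i1) sub1 _).2; rewrite s8.
have eq2 : P i2 =i E2 by apply: (uniq_min_size (rp_uniq rP i2) sub2 _).2; rewrite s8.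
have M246 : signed_triple s (h i1) g4 g6.
  by apply: (dec_line D) => *; rewrite eq1 mem_cat mem_signed_pairs.
have M257 : signed_triple s (h i1) g5 g7.
  by apply: (dec_line D) => *; rewrite eq1 mem_cat mem_signed_pairs ?orbT.
have M347 : signed_triple s (h i2) g4 g7.
  by apply: (dec_line D) => *; rewrite eq2 mem_cat mem_signed_pairs.
have M356 : signed_triple s (h i2) g5 g6.
  by apply: (dec_line D) => *; rewrite eq2 mem_cat mem_signed_pairs ?orbT.
have M145 : signed_triple s (h i0) g4 g5.
  apply: (dec_line D) => e1 e2 [] -> [] ->.
  - by apply: eqm aP _; rewrite /g4 /g5; vec_pure.
  - by apply: eqm bP _; rewrite /g4 /g5; vec_pure.
  - by apply: eqm bP' _; rewrite /g4 /g5; vec_pure.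
  - by apply: eqm aP' _; rewrite /g4 /g5; vec_pure.
have M167 : signed_triple s (h i0) g6 g7.
  apply: (dec_line D) => e1 e2 [] -> [] ->.
  - by apply: eqm cP _; rewrite /g6 /g7; vec_pure.
  - by apply: eqm eP _; rewrite /g6 /g7; vec_pure.
  - by apply: eqm eP' _; rewrite /g6 /g7; vec_pure.
  - by apply: eqm cP' _; rewrite /g6 /g7; vec_pure.
have inR u : u \in [:: a; b; c; e] -> u \in span (all_roots P).
  by move=> uQ; apply/memv_span/mem_all_roots; exists i0; have [] := QP u uQ.
have og : orthonormal_seq [:: g4; g5; g6; g7].
  rewrite /= /g4 /g5 /g6 /g7; split; last split; last split; last split=> //.
  - by rewrite !dotE (dotC b a) aa bb ab; clear; lra.
  - move=> z; rewrite !inE => /or3P[] /eqP ->; rewrite !dotE ?(dotC b a)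
      ?aa ?bb ?ab ?ac ?ae ?bc ?be; clear; lra.
  - by rewrite !dotE (dotC b a) aa bb ab; clear; lra.
  - move=> z; rewrite !inE => /orP[] /eqP ->; rewrite !dotE ?ac ?ae ?bc ?be; clear; lra.
  - by rewrite !dotE (dotC e c) cc ee ce; clear; lra.
  - move=> z; rewrite !inE => /eqP ->; rewrite !dotE (dotC e c) cc ee ce; clear; lra.
  - by rewrite !dotE (dotC e c) cc ee ce; clear; lra.
have gR : {in [:: g4; g5; g6; g7], forall g, g \in span (all_roots P)}.
  move=> g; rewrite !inE /g4 /g5 /g6 /g7.
  by case/or4P => /eqP ->; apply: memvZ;
    [apply: memvD|apply: memvB|apply: memvD|apply: memvB];
    exact: inR.
have ou : orthonormal_family
    (fun i : 'I_7 => [:: h i0; h i1; h i2; g4; g5; g6; g7]`_i).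
  apply: (@orthonormal_seq_family _ _ [:: h i0; h i1; h i2; g4; g5; g6; g7]).
  apply: (orthonormal_seq_cat (orthonormal_frame hh) og) => u v.
  move=> + vg; rewrite !inE => /or3P[] /eqP ->;
    by apply: (dec_span_orth _ D); exact: gR.
exists (hadamard_simplex (h i0) (h i1) (h i2) g4 g5 g6 g7); split.
  exact: hadamard_simplexP.
move=> i j ij; apply: hadamard_simplex_mem => //; exact: (dec_base D).
Qed.

End FullRootSystem.

(** * The bound for finite systems *)

Section Extremal.
Context {R : realType} {d : nat}.
Implicit Types (s : seq 'rV[R]_d).

Definition max_lines (r : nat) : nat :=
  (if r == 5 then 10 else if r == 6 then 16 else if r == 7 then 28
   else 2 * (r - 1))%N.

(** In the last case [h0] and [- h0] stand for the vertices on one side of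
    K_{2,r-1}, and the [q i] for those on the other side. *)
Definition extremal s (r : nat) : Prop :=
  if r == 5%N then exists f : 'I_5 -> 'rV[R]_d, simplex f /\
    forall i j, i != j -> mem_pm s (f i + f j)
  else if r == 6%N then exists f : 'I_6 -> 'rV[R]_d, [/\ simplex f,
    forall i j, i != j -> mem_pm s (f i + f j) & mem_pm s (\sum_i f i)]
  else if r == 7%N then exists f : 'I_8 -> 'rV[R]_d, simplex f /\
    forall i j, i != j -> mem_pm s (f i + f j)
  else exists (h0 : 'rV[R]_d) (q : 'I_(r - 1) -> 'rV[R]_d),
    [/\ dot h0 h0 = 1, forall i, dot h0 (q i) = 0,
        forall i j, dot (q i) (q j) = 2 * (i == j)%:R &
        forall i, mem_pm s (h0 + q i) /\ mem_pm s (- h0 + q i)].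

Lemma decomposition_extremal s h P : decomposition s h P ->
  let r := \dim (span s) in
  (size s <= max_lines r)%N /\ (size s = max_lines r -> extremal s r).
Proof.
move=> D r; have rE := dec_dim D; rewrite -/r in rE.
have sE := dec_size D; have rP := dec_roots D.
set m := \dim (span (all_roots P)) in rE.
have I3 (T : 'I_3 -> Prop) : T i0 -> T i1 -> T i2 -> forall j, T j.
  by move=> ? ? ? j; case: (I3P j) => ->.
case: (pselect (exists k l x y, [/\ k != l, x \in P k & y \in P l])).
  move=> [k [l [x [y [kl xk yl]]]]].
  have := several_pillars_bound rP kl xk yl; rewrite -/m => -[[]|[[]|[]]] mE le;
    have le0 := le i0; have le1 := le i1; have le2 := le i2;
    rewrite rE mE sE /max_lines /extremal /=.
  - split; first by lia.
    move=> e; apply: (simplex5_of_pillars D kl xk yl mE); apply: I3; lia.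
  - split; first by lia.
    move=> e; apply: (simplex6_of_pillars D kl xk yl mE); apply: I3; lia.
  - split; first by lia.
    move=> e; apply: (simplex8_of_pillars D kl xk yl mE); apply: I3; lia.
move=> no.
have [k Pk] : exists k, forall l, l != k -> P l = [::].
  case: (pselect (exists k x, x \in P k)) => [[k [x xk]]|no'].
    exists k => l lk; case E : (P l) => [//|y t]; case: no.
    by exists l, k, y, x; rewrite E mem_head.
  exists i0 => l _; case E : (P l) => [//|y t]; case: no'.
  by exists l, y; rewrite E mem_head.
have [le eq] := single_pillar rP Pk; rewrite -/m in le eq.
have {}sE : size s = (4 + size (P k))%N.
  rewrite sE; have H l : l != k -> size (P l) = 0%N by move=> /Pk ->.
  move: H; case: (I3P k) => -> H.
  - by rewrite (H i1)// (H i2)// !addn0.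
  - by rewrite (H i0)// (H i2)// addn0.
  - by rewrite (H i0)// (H i1)//.
rewrite /max_lines /extremal.
do 3 (case: eqVneq => [re|_]; first by split; lia).
split; first by lia.
move=> e; have r1 : (r - 1 = m + 2)%N by lia.
rewrite r1; apply: (single_pillar_frame D Pk); rewrite -/m; lia.
Qed.

(** If the fourth vector of a triangle is missing, it can be added without changing
    the rank, so the system is not of maximal size. *)
Lemma sign_system_extremal s : sign_system s -> let r := \dim (span s) in (3 <= r)%N ->
  (size s <= max_lines r)%N /\ (size s = max_lines r -> extremal s r).
Proof.
move=> es r r3.
case: (pselect (exists p1 p2 p3, triangle s p1 p2 p3)) => [[p1 [p2 [p3 T]]]|no].
  have B t : sign_system t -> triangle t p1 p2 p3 -> mem_pm t (- (p1 + p2 + p3)) ->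
      let r := \dim (span t) in
      (size t <= max_lines r)%N /\ (size t = max_lines r -> extremal t r).
    move=> et Tt m4; have [h [hh Bh]] := frame_of_triangle et Tt m4.
    have [P D] := decomposition_exists et hh Bh.
    exact: decomposition_extremal D.
  case m4 : (mem_pm s (- (p1 + p2 + p3))); first exact: B.
  have [es' sp] := triangle_fourth es T (negbT m4).
  have mm u : mem_pm s u -> mem_pm (- (p1 + p2 + p3) :: s) u.
    by rewrite /mem_pm !inE => /orP[] ->; rewrite !orbT.
  have [||le _] := B _ es'; first by case: T => -[? ? ?] ?; split=> //; split; exact: mm.
    by rewrite mem_pmW ?mem_head.
  move: le; rewrite sp /= -/r => le; split; first exact: ltnW.
  by move=> e; rewrite e ltnn in le.
have fs := no_triangle_free es no.
have lt : (size s < max_lines r)%N.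
  by rewrite -(eqP fs) -/r /max_lines; do 3 (case: eqVneq => [->//|_]); lia.
by split; [exact: ltnW|move=> e; rewrite e ltnn in lt].
Qed.

End Extremal.

(** * Vector models of the extremal graphs *)

Section Graphs.
Context {R : realType} {d : nat}.
Implicit Types (s : seq 'rV[R]_d).

(** These products are the entries of [3 I - S] for the Seidel matrix [S]. *)
Definition graph_frame (H : sgraph) (w : H -> 'rV[R]_d) : Prop :=
  forall x y, dot (w x) (w y) = if x == y then 3 else if adj x y then 1 else -1.

Lemma edges_complete n : edges (complete n) = [set A : {set 'I_n} | #|A| == 2]%SET.
Proof.
apply/setP => A; rewrite !inE; apply/existsP/cards2P.
  case=> x /existsP[y /andP[xy /eqP ->]]; exists x, y => //.
by case=> x [y [xy ->]]; exists x; apply/existsP; exists y; rewrite eqxx andbT.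
Qed.

Lemma card_line_graph_complete n : #|line_graph (complete n)| = 'C(n, 2).
Proof. by rewrite card_sig edges_complete -[in RHS](card_ord n) -card_draws. Qed.

Lemma card_edge_complete n (e : line_graph (complete n)) :
  #|(val e : {set 'I_n})| = 2%N.
Proof.
have : val e \in edges (complete n) := valP e.
by move: (val e) => A; rewrite edges_complete inE => /eqP.
Qed.

Lemma edge_completeP n (e : line_graph (complete n)) :
  exists x y : 'I_n, x != y /\ val e = [set x; y]%SET.
Proof. by apply/cards2P; rewrite card_edge_complete. Qed.

Lemma pair_edge_complete n (x y : 'I_n) : x != y ->
  exists e : line_graph (complete n), val e = [set x; y]%SET.
Proof.
move=> xy; have h : [set x; y]%SET \in edges (complete n).
  by rewrite edges_complete inE cards2 xy.
by exists (exist (fun A => is_true (A \in edges (complete n))) [set x; y]%SET h).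
Qed.

Section Simplex.
Variables (n : nat) (f : 'I_n -> 'rV[R]_d).
Hypothesis sf : simplex f.

Definition edge_vector (e : line_graph (complete n)) : 'rV[R]_d :=
  \sum_(i in (val e : {set 'I_n})) f i.

Lemma edge_vectorE (e : line_graph (complete n)) x y : x != y ->
  val e = [set x; y]%SET -> edge_vector e = f x + f y.
Proof.
by move=> xy eE; rewrite /edge_vector eE big_setU1 ?inE // big_set1.
Qed.

(** Each common end of two edges contributes 2 to the product, and the four pairs of
    ends contribute -1/4 each. *)
Lemma edge_vector_frame : graph_frame edge_vector.
Proof.
move=> e e'; have c2 := @card_edge_complete n.
have -> : dot (edge_vector e) (edge_vector e') =
    2 * #|(val e :&: val e' : {set 'I_n})%SET|%:R - 1.
  rewrite dot_suml (eq_bigr (fun i => 2 * (i \in (val e' : {set 'I_n}))%:R - 2^-1)).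
    rewrite big_split /= sumr_const c2 -mulr_sumr -natr_sum.
    suff -> : (\sum_(i in (val e : {set 'I_n})) (i \in (val e' : {set 'I_n})) =
        #|(val e :&: val e' : {set 'I_n})%SET|)%N by lra.
    rewrite -sum1_card big_mkcond [RHS]big_mkcond; apply: eq_bigr => i _.
    by rewrite finset.in_setI; case: (i \in _).
  move=> i _; rewrite dot_sumr (eq_bigr (fun j => 2 * (i == j)%:R - 4^-1)).
    rewrite big_split /= sumr_const c2 -mulr_sumr; congr (2 * _ + _); last by lra.
    case ie : (i \in _); last first.
      by rewrite big1 // => j je'; case: eqVneq => // ij; rewrite ij je' in ie.
    by rewrite (bigD1 i) //= eqxx big1 ?addr0 // => j /andP[_ /negPf]; rewrite eq_sym => ->.
  by move=> j _; exact: sf.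
have [<-|ne] := eqVneq e e'; first by rewrite finset.setIid c2; lra.
have lt : (#|(val e :&: val e' : {set 'I_n})%SET| < 2)%N.
  rewrite ltn_neqAle -{2}(c2 e) subset_leq_card ?subsetIl // andbT.
  apply: contra_neq ne => h; apply/val_inj/eqP.
  have /eqP eI : (val e :&: val e' == val e :> {set 'I_n})%SET.
    by rewrite eqEcard subsetIl c2 h /=.
  by rewrite eqEcard !c2 leqnn andbT -eI subsetIr.
rewrite /adj /= /line_graph_rel ne /= -card_gt0.
by case: #|_| lt => [|[|//]] _ /=; lra.
Qed.

End Simplex.
End Graphs.

Section Frames.
Context {R : realType} {d : nat}.

Lemma simplex_sum_dot n (f : 'I_n -> 'rV[R]_d) i : simplex f ->
  dot (\sum_j f j) (f i) = 2 - n%:R / 4.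
Proof.
move=> sf; rewrite dot_suml (eq_bigr (fun j => 2 * (j == i)%:R - 4^-1)) => [|j _].
  rewrite big_split /= sumr_const card_ord (bigD1 i) //= eqxx big1.
    by rewrite mulNrn -mulr_natl mulrC /=; lra.
  by move=> j /negPf ->; rewrite mulr0.
exact: sf.
Qed.

(** The negated sum of six simplex vectors has norm 3, and product -1/2 with each of
    them. *)
Definition apex_vector (f : 'I_6 -> 'rV[R]_d)
    (x : dunion (line_graph (complete 6)) (complete 1)) : 'rV[R]_d :=
  match x with inl e => edge_vector f e | inr _ => - \sum_i f i end.

Lemma apex_vector_frame f : simplex f -> graph_frame (apex_vector f).
Proof.
move=> sf; have sE e : dot (\sum_i f i) (edge_vector f e) = 1.
  have [x [y [xy eE]]] := edge_completeP e.
  by rewrite (edge_vectorE _ xy eE) dotDr !simplex_sum_dot //; lra.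
case=> [e|x] [e'|y].
- exact: edge_vector_frame.
- by rewrite /= dotNr dotC sE.
- by rewrite /= dotNl sE.
- rewrite (ord1 x) (ord1 y) eqxx /= dotNl dotNr opprK dot_sumr.
  rewrite (eq_bigr (fun=> 2^-1)) => [|i _]; last by rewrite simplex_sum_dot //; lra.
  by rewrite sumr_const card_ord; lra.
Qed.

Lemma card_apex_graph : #|dunion (line_graph (complete 6)) (complete 1)| = 16%N.
Proof. by rewrite card_sum card_line_graph_complete card_ord. Qed.

Section Bipartite.
Variables (b : nat).
Implicit Types (c : 'I_2) (i : 'I_b).

Let S c i : {set complete_bip 2 b} := [set inl c; inr i]%SET.

Lemma mem_edge_bipl c i c' : (inl c' \in S c i) = (c' == c).
Proof. by rewrite finset.in_set2 orbF. Qed.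

Lemma mem_edge_bipr c i i' : (inr i' \in S c i) = (i' == i).
Proof. by rewrite finset.in_set2. Qed.

Lemma eq_edge_bip c i c' i' : (S c i == S c' i') = (c == c') && (i == i').
Proof.
apply/eqP/andP => [e|[/eqP -> /eqP ->]//].
have : inl c \in S c' i' by rewrite -e (mem_edge_bipl, mem_edge_bipr) eqxx.
have : inr i \in S c' i' by rewrite -e (mem_edge_bipl, mem_edge_bipr) eqxx.
by rewrite !(mem_edge_bipl, mem_edge_bipr).
Qed.

Lemma meet_edge_bip c i c' i' :
  (S c i :&: S c' i' != finset.set0)%SET = (c == c') || (i == i').
Proof.
apply/set0Pn/orP => [[x]|[/eqP ->|/eqP ->]].
- rewrite finset.in_setI; case: x => x; rewrite !(mem_edge_bipl, mem_edge_bipr);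
    move=> /andP[/eqP -> ->].
    by left.
  by right.
- by exists (inl c'); rewrite finset.in_setI !(mem_edge_bipl, mem_edge_bipr) eqxx.
- by exists (inr i'); rewrite finset.in_setI !(mem_edge_bipl, mem_edge_bipr) eqxx.
Qed.

Lemma edges_bip : edges (complete_bip 2 b) =
  [set S p.1 p.2 | p in [set: 'I_2 * 'I_b]]%SET.
Proof.
apply/setP => A; rewrite inE; apply/existsP/imsetP.
  case=> [[c|i]] /existsP[[c'|i']] //= /eqP ->.
    by exists (c, i'); rewrite ?finset.in_setT.
  by exists (c', i); rewrite ?finset.in_setT // finset.setUC.
case=> [[c i]] _ ->; exists (inl c); apply/existsP; exists (inr i).
by rewrite eqxx.
Qed.

Lemma card_line_graph_bip : #|line_graph (complete_bip 2 b)| = (2 * b)%N.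
Proof.
rewrite card_sig edges_bip card_imset; first by rewrite cardsT card_prod !card_ord.
by move=> [c i] [c' i'] /eqP; rewrite eq_edge_bip => /andP[/eqP /= -> /eqP /= ->].
Qed.

Lemma edge_bipP (e : line_graph (complete_bip 2 b)) :
  exists c i, val e = S c i.
Proof.
have : val e \in edges (complete_bip 2 b) := valP e.
move: (val e) => A; rewrite edges_bip => /imsetP[[c i] _ ->].
by exists c, i.
Qed.

Lemma pair_edge_bip c i : exists e : line_graph (complete_bip 2 b), val e = S c i.
Proof.
have h : S c i \in edges (complete_bip 2 b).
  by rewrite edges_bip; apply/imsetP; exists (c, i).
by exists (exist (fun A => is_true (A \in edges (complete_bip 2 b))) (S c i) h).
Qed.

Variables (h0 : 'rV[R]_d) (q : 'I_b -> 'rV[R]_d).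

Definition bip_vertex_vector (x : complete_bip 2 b) : 'rV[R]_d :=
  match x with
  | inl c => if c == ord0 then h0 else - h0
  | inr i => q i
  end.

Definition bip_vector (e : line_graph (complete_bip 2 b)) : 'rV[R]_d :=
  \sum_(x in (val e : {set complete_bip 2 b})) bip_vertex_vector x.

Lemma bip_vectorE e c i : val e = S c i ->
  bip_vector e = (if c == ord0 then h0 else - h0) + q i.
Proof.
by move=> eE; rewrite /bip_vector eE big_setU1 ?inE //= big_set1.
Qed.

Lemma bip_vector_frame : dot h0 h0 = 1 -> (forall i, dot h0 (q i) = 0) ->
  (forall i j, dot (q i) (q j) = 2 * (i == j)%:R) -> graph_frame bip_vector.
Proof.
move=> h1 hq qq e e'.
have [c [i eE]] := edge_bipP e; have [c' [i' eE']] := edge_bipP e'.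
rewrite (bip_vectorE eE) (bip_vectorE eE') /adj /= /line_graph_rel.
rewrite -[e == e']val_eqE eE eE' eq_edge_bip meet_edge_bip.
have -> : (c == c') = ((c == ord0) == (c' == ord0)).
  by case: c {eE} => [[|[|//]] ?]; case: c' {eE'} => [[|[|//]] ?].
by case: (c == ord0); case: (c' == ord0); rewrite !dotE (dotC (q i) h0) h1 !hq qq /=;
  case: (i == i') => /=; lra.
Qed.

End Bipartite.
End Frames.

Section Existence.
Context {R : realType}.

Definition frame_span (H : sgraph) d (w : H -> 'rV[R]_d) : {vspace 'rV[R]_d} :=
  span [seq w x | x <- enum H].

Lemma frame_span_mem (H : sgraph) d (w : H -> 'rV[R]_d) x : w x \in frame_span w.
Proof. by apply/memv_span/map_f; rewrite mem_enum. Qed.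

Lemma frame_span_sub (H : sgraph) d (w : H -> 'rV[R]_d) (W : {vspace 'rV[R]_d}) :
  (forall x, w x \in W) -> (frame_span w <= W)%VS.
Proof. by move=> wW; apply/span_subvP => u /mapP[x _ ->]. Qed.

Lemma simplex_inj n d (f : 'I_n -> 'rV[R]_d) : simplex f -> injective f.
Proof.
move=> sf i j e; have := sf i j; rewrite e sf eqxx.
by case: eqVneq => // _ /= h; exfalso; move: h; clear => h; lra.
Qed.

Lemma simplex_free n d (f : 'I_n -> 'rV[R]_d) : (n < 8)%N -> simplex f ->
  free [seq f i | i <- enum 'I_n].
Proof.
move=> n8 sf; apply: (@free_gram _ _ _ (fun=> 1) 2 (- 4^-1)).
- by rewrite (map_inj_uniq (simplex_inj sf)) enum_uniq.
- by rewrite pnatr_eq0.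
- rewrite size_map size_enum_ord; have : n%:R <= 7%:R :> R by rewrite ler_nat.
  by move=> h; apply/eqP => h'; lra.
- by move=> *; exact: oner_neq0.
- move=> _ _ /mapP[i _ ->] /mapP[j _ ->]; rewrite sf (inj_eq (simplex_inj sf)); lra.
Qed.

Lemma simplex_dim n d (f : 'I_n -> 'rV[R]_d) : (n < 8)%N -> simplex f ->
  \dim (span [seq f i | i <- enum 'I_n]) = n.
Proof.
by move=> n8 sf; rewrite (eqP (simplex_free n8 sf)) size_map size_enum_ord.
Qed.

(** The sum of eight simplex vectors has norm zero, and any seven are independent. *)
Lemma simplex8_dim d (f : 'I_8 -> 'rV[R]_d) : simplex f ->
  \dim (span [seq f i | i <- enum 'I_8]) = 7%N.
Proof.
move=> sf; pose g (i : 'I_7) := f (widen_ord (leqnSn 7) i).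
have sg : simplex g by move=> i j; rewrite /g sf -val_eqE.
rewrite -[RHS](simplex_dim (n := 7) isT sg); congr (\dim _); apply/eqP.
have s0 : \sum_i f i = 0.
  apply: dot_eq0; rewrite dot_sumr big1 // => i _.
  by rewrite simplex_sum_dot //; lra.
have gs i : g i \in span [seq g i | i <- enum 'I_7].
  by apply/memv_span/map_f; rewrite mem_enum.
rewrite eqEsubv; apply/andP; split; apply/span_subvP => _ /mapP[i _ ->].
  case: (unliftP ord_max i) => [j ->|->].
    suff -> : f (lift ord_max j) = g j by [].
    by congr f; apply: val_inj; rewrite /= /bump leqNgt ltn_ord.
  move: s0; rewrite big_ord_recr /= => /eqP; rewrite addrC addr_eq0 => /eqP ->.
  by rewrite memvN memv_suml // => j _; exact: gs.
by apply/memv_span/map_f; rewrite mem_enum.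
Qed.

(** [2 f i = (f i + f j) + (f i + f k) - (f j + f k)]. *)
Lemma frame_span_edges n d (f : 'I_n -> 'rV[R]_d) : (2 < n)%N ->
  frame_span (edge_vector f) = span [seq f i | i <- enum 'I_n].
Proof.
move=> n2; have fs i : f i \in span [seq f i | i <- enum 'I_n].
  by apply/memv_span/map_f; rewrite mem_enum.
apply/eqP; rewrite eqEsubv; apply/andP; split.
  by apply: frame_span_sub => e; rewrite /edge_vector memv_suml.
apply/span_subvP => _ /mapP[i _ ->].
have ff x y : x != y -> f x + f y \in frame_span (edge_vector f).
  move=> xy; have [e eE] := pair_edge_complete xy.
  by rewrite -(edge_vectorE f xy eE) frame_span_mem.
have [j [k [ij ik jk]]] : exists j k : 'I_n, [/\ i != j, i != k & j != k].
  have : (1 < #|[set~ i]%SET|)%N by rewrite cardsC1 card_ord; lia.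
  case/card_gt1P => j [k [+ + jk]]; rewrite !inE => ji ki.
  by exists j, k; rewrite !(eq_sym i).
have := memvB (memvD (ff _ _ ij) (ff _ _ ik)) (ff _ _ jk).
move=> /(memvZ 2^-1); rewrite (_ : _ *: _ = f i) //.
by apply/rowP => x; rewrite !mxE; lra.
Qed.

Lemma dot_delta d (i j : 'I_d) :
  dot (delta_mx 0 i : 'rV[R]_d) (delta_mx 0 j) = (i == j)%:R.
Proof.
rewrite /dot (bigD1 i) //= big1 ?addr0 => [|k /negPf ki].
  by rewrite !mxE !eqxx mul1r.
by rewrite !mxE ki andbF mul0r.
Qed.

(** A regular simplex with eight vertices, centred at the origin and with edges of
    length 2. *)
Lemma simplex_exists n : (n <= 8)%N -> exists f : 'I_n -> 'rV[R]_8, simplex f.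
Proof.
move=> n8; pose c : 'rV[R]_8 := const_mx 8^-1.
exists (fun i => Num.sqrt 2 *: (delta_mx 0 (widen_ord n8 i) - c)) => i j.
have cc : dot c c = 8^-1.
  rewrite /dot (eq_bigr (fun=> 8^-1 * 8^-1)) => [|k _]; last by rewrite !mxE.
  by rewrite sumr_const card_ord; lra.
have dc (k : 'I_8) : dot (delta_mx 0 k) c = 8^-1.
  rewrite /dot (bigD1 k) //= big1 ?addr0 => [|k' /negPf ki].
    by rewrite !mxE !eqxx mul1r.
  by rewrite !mxE ki andbF mul0r.
rewrite dotZl dotZr mulrA -expr2 sqr_sqrtr // !(dotDl, dotDr, dotNl, dotNr).
rewrite (dotC c) !dc cc dot_delta -[_ == _ :> 'I_8]val_eqE -[i == j]val_eqE /=; lra.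
Qed.

Definition extremal_graph (r : nat) : sgraph :=
  if r == 5%N then line_graph (complete 5)
  else if r == 6%N then dunion (line_graph (complete 6)) (complete 1)
  else if r == 7%N then line_graph (complete 8)
  else line_graph (complete_bip 2 (r - 1)).

Lemma card_extremal_graph r : #|extremal_graph r| = max_lines r.
Proof.
rewrite /extremal_graph /max_lines; case: ifP => _.
  by rewrite card_line_graph_complete.
case: ifP => _; first exact: card_apex_graph.
case: ifP => _; first by rewrite card_line_graph_complete.
exact: card_line_graph_bip.
Qed.

Lemma extremal_graph_frame_exists r : (3 <= r)%N ->
  exists d (w : extremal_graph r -> 'rV[R]_d), graph_frame w /\ \dim (frame_span w) = r.
Proof.
move=> r3; rewrite /extremal_graph.
case: eqVneq => [->|_].
  have [f sf] := @simplex_exists 5 isT; exists 8, (edge_vector f).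
  by split; [exact: edge_vector_frame|rewrite frame_span_edges // simplex_dim].
case: eqVneq => [->|_].
  have [f sf] := @simplex_exists 6 isT; exists 8, (apex_vector f).
  split; first exact: apex_vector_frame.
  rewrite -[RHS](simplex_dim (n := 6) isT sf) -frame_span_edges //.
  congr (\dim _); apply/eqP; rewrite eqEsubv; apply/andP; split.
    apply: frame_span_sub => -[e|x] /=; first exact: frame_span_mem.
    rewrite memvN frame_span_edges // memv_suml // => i _.
    by apply/memv_span/map_f; rewrite mem_enum.
  by apply: frame_span_sub => e; exact: (frame_span_mem (apex_vector f) (inl e)).
case: eqVneq => [->|_].
  have [f sf] := @simplex_exists 8 isT; exists 8, (edge_vector f).
  by split; [exact: edge_vector_frame|rewrite frame_span_edges // simplex8_dim].
case: r r3 => // b b3; rewrite subSS subn0.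
have b2 : (0 < b)%N by case: b b3.
pose h0 : 'rV[R]_b.+1 := delta_mx 0 ord0.
pose q (i : 'I_b) : 'rV[R]_b.+1 := Num.sqrt 2 *: delta_mx 0 (lift ord0 i).
have s2 : Num.sqrt 2 * Num.sqrt 2 = 2 :> R by rewrite -expr2 sqr_sqrtr.
have qq i j : dot (q i) (q j) = 2 * (i == j)%:R.
  by rewrite dotZ s2 dot_delta (inj_eq lift_inj).
exists b.+1, (bip_vector h0 q); split.
  apply: bip_vector_frame => //; first by rewrite dot_delta eqxx.
  by move=> i; rewrite dotZr dot_delta mulr0.
set W := frame_span _.
have bip (c : 'I_2) i : (if c == ord0 then h0 else - h0) + q i \in W.
  have [e eE] := pair_edge_bip c i.
  by rewrite -(bip_vectorE h0 q eE) frame_span_mem.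
have qW i : q i \in W.
  have := memvD (bip ord0 i) (bip ord_max i).
  move=> /(memvZ 2^-1); rewrite (_ : _ *: _ = q i) //=.
  by apply/rowP => x; rewrite !mxE; clear; lra.
have hW : h0 \in W.
  have := memvB (bip ord0 (Ordinal b2)) (qW (Ordinal b2)).
  by rewrite /= addrK.
have dW k : delta_mx 0 k \in W.
  case: (unliftP ord0 k) => [j|] -> //.
  rewrite -[delta_mx _ _]scale1r -(_ : 2^-1 * Num.sqrt 2 * Num.sqrt 2 = 1).
    by rewrite -scalerA; apply: memvZ; exact: qW.
  by rewrite -mulrA s2 mulVf.
have -> : W = fullv.
  apply/eqP; rewrite eqEsubv subvf; apply/subvP => v _.
  by rewrite (row_sum_delta v) memv_suml // => k _; rewrite memvZ.
by rewrite dimvf /dim /= mul1n.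
Qed.

End Existence.

(** * Equiangular lines *)

Lemma card_seq (T : eqType) (t : seq T) : uniq t -> [set` t] #= `I_(size t).
Proof.
case: t => [|x0 t0] ut.
  have -> : [set` [::]] = set0 :> set T by apply/seteqP; split=> x.
  by rewrite II0.
set t := x0 :: t0 in ut *.
rewrite (_ : [set` t] = [set nth x0 t i | i in `I_(size t)]).
  apply: inj_card_eq => i j; rewrite !inE => hi hj /eqP.
  by rewrite nth_uniq // => /eqP.
apply/seteqP; split=> [x /= xt|_ /= [i it <-]]; last exact: mem_nth.
have lt : (index x t < size t)%N by rewrite index_mem.
by exists (index x t); [exact: lt|exact: nth_index].
Qed.

Section Lines.
Context {R : realType} {d : nat}.
Implicit Types (u v w y : 'rV[R]_d) (s : seq 'rV[R]_d).
Implicit Types (L M W : {vspace 'rV[R]_d}) (X : set {vspace 'rV[R]_d}).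

Lemma norm3_neq0 u : dot u u = 3 -> u != 0.
Proof. by move=> uu; apply/eqP => u0; move: uu; rewrite u0 dot0l; clear; lra. Qed.

Lemma norm3_enorm u : dot u u = 3 -> enorm u = Num.sqrt 3.
Proof. by rewrite /enorm => ->. Qed.

Lemma sqrt3M : Num.sqrt 3 * Num.sqrt 3 = 3 :> R.
Proof. by rewrite -expr2 sqr_sqrtr. Qed.

Lemma is_line_vline u : u != 0 -> is_line <[u]>%VS.
Proof. by rewrite /is_line dim_vline => ->. Qed.

Lemma vlineN u : (<[- u]> = <[u]>)%VS.
Proof.
apply/eqP; rewrite eqEsubv -!memvE memvN memv_line /=.
by rewrite -[u in u \in _]opprK memvN memv_line.
Qed.

Lemma vline_norm3_eq u v : dot u u = 3 -> dot v v = 3 ->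
  (<[u]> = <[v]>)%VS -> u = v \/ u = - v.
Proof.
move=> uu vv uv; have /vlineP[k kE] : u \in <[v]>%VS by rewrite -uv memv_line.
have kk : k * k = 1.
  by move: uu; rewrite kE dotZl dotZr vv => h; clear -h; lra.
by case: (is_sign_sqr kk) => k1; [left|right]; rewrite kE k1 ?scale1r ?scaleN1r.
Qed.

Lemma line_angle_norm3 u v : dot u u = 3 -> dot v v = 3 ->
  line_angle <[u]>%VS <[v]>%VS = acos (`|dot u v| / 3).
Proof.
move=> uu vv; have u0 := norm3_neq0 uu; have v0 := norm3_neq0 vv.
rewrite (line_angle_eq (u := u) (v := v)) ?memv_line //; try exact: is_line_vline.
by rewrite !norm3_enorm // sqrt3M.
Qed.

Lemma line_angle_third u v : dot u u = 3 -> dot v v = 3 ->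
  line_angle <[u]>%VS <[v]>%VS = acos (1 / 3) -> is_sign (dot u v).
Proof.
move=> uu vv; rewrite line_angle_norm3 // => /(congr1 cos).
have /andP[b1 b2] : - 3 <= dot u v <= 3 by apply: (dot_bounded _ uu vv); lra.
have n0 : 0 <= `|dot u v| by exact: normr_ge0.
have n3 : `|dot u v| <= 3 by rewrite ler_norml b1 b2.
rewrite !acosK ?in_itv /=; try (apply/andP; split; lra).
move=> h; have {h} : `|dot u v| = 1 by lra.
by move/eqP; rewrite eqr_norml ler01 andbT => /orP[] /eqP; [left|right].
Qed.

Definition line_vector L : 'rV[R]_d :=
  (Num.sqrt 3 / enorm (vpick L)) *: vpick L.

Lemma line_vectorP L : is_line L ->
  dot (line_vector L) (line_vector L) = 3 /\ L = <[line_vector L]>%VS.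
Proof.
move=> lL; have p0 : vpick L != 0.
  by rewrite vpick0; apply/eqP => L0; move: lL; rewrite /is_line L0 dimv0.
have d0 : 0 < dot (vpick L) (vpick L).
  rewrite lt_neqAle dot_ge0 andbT eq_sym; apply: contra_neq p0; exact: dot_eq0.
have e2 : enorm (vpick L) * enorm (vpick L) = dot (vpick L) (vpick L).
  by rewrite -expr2 sqr_sqrtr // ltW.
have e0 : enorm (vpick L) != 0 by rewrite gt_eqF // sqrtr_gt0.
have n3 : dot (line_vector L) (line_vector L) = 3.
  rewrite dotZ mulrACA sqrt3M -invfM e2 mulfVK //; exact: lt0r_neq0.
split=> //; apply/esym/eqP; rewrite eqEdim dim_vline (norm3_neq0 n3) lL leqnn andbT.
by rewrite -memvE memvZ // memv_pick.
Qed.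

Lemma lines_sign_system X (t : seq {vspace 'rV[R]_d}) : equiangular X (1 / 3) ->
  uniq t -> {in t, forall L, X L} -> sign_system [seq line_vector L | L <- t].
Proof.
move=> [lX aX] ut tX.
have lv L : L \in t -> dot (line_vector L) (line_vector L) = 3 /\
    L = <[line_vector L]>%VS.
  by move=> /tX /lX; exact: line_vectorP.
split.
- rewrite map_inj_in_uniq // => L M Lt Mt e.
  by rewrite (lv L Lt).2 (lv M Mt).2 e.
- by move=> _ /mapP[L Lt ->]; have [] := lv L Lt.
- move=> _ _ /mapP[L Lt ->] /mapP[M Mt ->] ne.
  have [nL eL] := lv L Lt; have [nM eM] := lv M Mt.
  apply: line_angle_third => //; rewrite -eL -eM.
  apply: aX; [exact: tX|exact: tX|]; by move=> e; rewrite e eqxx in ne.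
Qed.

Lemma lines_mem_pm X (t : seq {vspace 'rV[R]_d}) y : equiangular X (1 / 3) ->
  {in t, forall L, X L} -> mem_pm [seq line_vector L | L <- t] y ->
  <[y]>%VS \in t.
Proof.
move=> [lX _] tX my.
have h z : z \in [seq line_vector L | L <- t] -> <[z]>%VS \in t.
  by move=> /mapP[L Lt ->]; rewrite -(line_vectorP (lX L (tX L Lt))).2.
by case/orP: my => /h //; rewrite vlineN.
Qed.

Lemma lines_span_le X (t : seq {vspace 'rV[R]_d}) W : equiangular X (1 / 3) ->
  {in t, forall L, X L} -> (forall L, X L -> (L <= W)%VS) ->
  (span [seq line_vector L | L <- t] <= W)%VS.
Proof.
move=> [lX _] tX XW; apply/span_subvP => _ /mapP[L Lt ->].
by rewrite memvE -(line_vectorP (lX L (tX L Lt))).2; apply/XW/tX.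
Qed.

Lemma lines_span X (t : seq {vspace 'rV[R]_d}) r : equiangular X (1 / 3) ->
  X = [set` t] -> lines_rank X r ->
  \dim (span [seq line_vector L | L <- t]) = r.
Proof.
move=> eX Xt [W [[XW Wmin] <-]]; congr (\dim _); apply/eqP; rewrite eqEsubv.
have tX : {in t, forall L, X L} by move=> L Lt; rewrite Xt.
rewrite (lines_span_le eX tX XW) /=; apply: Wmin => L XL.
have Lt : L \in t by move: XL; rewrite Xt.
rewrite {1}(line_vectorP (eX.1 L XL)).2 -memvE.
exact/memv_span/map_f.
Qed.

(** A crude bound, but monotone in the rank, so it also controls subsets whose span
    is smaller. *)
Lemma sign_system_size_le s : sign_system s -> (size s <= 28 + 2 * \dim (span s))%N.
Proof.
move=> es; case: (pselect (exists p1 p2 p3, triangle s p1 p2 p3)); last first.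
  by move=> /(no_triangle_free es) /eqP <-; lia.
move=> [p1 [p2 [p3 [[m1 m2 m3] [d12 d13 d23]]]]].
have [n1 n2 n3] := And3 (mem_pm_norm es m1) (mem_pm_norm es m2) (mem_pm_norm es m3).
have ne (p q : 'rV[R]_d) : dot p p = 3 -> dot p q = -1 -> p != q.
  by move=> pp pq; apply/eqP => e; move: pq; rewrite -e pp; clear; lra.
have [n12 n13 n23] := And3 (ne _ _ n1 d12) (ne _ _ n1 d13) (ne _ _ n2 d23).
have fp : free [:: p1; p2; p3].
  apply: (@free_gram _ _ _ (fun=> 1) 4 (-1)).
  - by rewrite /= !inE negb_or n12 n13 n23.
  - by rewrite pnatr_eq0.
  - by rewrite mulrN1 subr_eq0 eqr_nat.
  - by move=> *; exact: oner_neq0.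
  - move=> u v; rewrite !inE => /or3P[] /eqP -> /or3P[] /eqP ->;
    rewrite ?eqxx ?[p2 == p1]eq_sym ?[p3 == p1]eq_sym ?[p3 == p2]eq_sym
      ?(negPf n12) ?(negPf n13) ?(negPf n23) ?(dotC p2 p1) ?(dotC p3 p1) ?(dotC p3 p2)
      ?n1 ?n2 ?n3 ?d12 ?d13 ?d23 /=; clear; lra.
have r3 : (3 <= \dim (span s))%N.
  rewrite -[3%N]/(size [:: p1; p2; p3]) -(eqP fp); apply/dimvS/span_subvP => u.
  by rewrite !inE => /or3P[] /eqP ->; apply: mem_pm_span.
have [le _] := sign_system_extremal es r3; apply: leq_trans le _.
rewrite /max_lines; do 3 (case: eqVneq => [->//|_]); lia.
Qed.

(** Otherwise there are finite subsets of any size, all of rank at most [r]. *)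
Lemma equiangular_finite X r : equiangular X (1 / 3) -> lines_rank X r ->
  finite_set X.
Proof.
move=> eX [W [[XW _] Wr]]; apply: contrapT => infX.
have [B BX sB] := infinite_set_fset (29 + 2 * r) infX.
have uB : uniq (finmap.enum_fset B) by exact: finmap.fset_uniq.
have tX : {in finmap.enum_fset B, forall L, X L} by move=> L LB; exact: BX.
have := sign_system_size_le (lines_sign_system eX uB tX); rewrite size_map => le.
have := leq_trans sB le; have := dimvS (lines_span_le eX tX XW); rewrite Wr.
by move: (\dim _) => m; lia.
Qed.

Lemma equiangular_seq X r : equiangular X (1 / 3) -> lines_rank X r ->
  exists t, [/\ uniq t, X = [set` t] & sign_system [seq line_vector L | L <- t]].
Proof.
move=> eX rX; have /finite_seqP[t Xt] := equiangular_finite eX rX.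
have Xu : X = [set` undup t].
  by rewrite Xt; apply/seteqP; split=> L /=; rewrite mem_undup.
exists (undup t); split; rewrite ?undup_uniq //.
apply: (lines_sign_system eX); rewrite ?undup_uniq // => L Lt; by rewrite Xu.
Qed.

Lemma equiangular_card_le X r : (3 <= r)%N -> equiangular X (1 / 3) ->
  lines_rank X r -> X #<= `I_(max_lines r).
Proof.
move=> r3 eX rX; have [t [ut Xt es]] := equiangular_seq eX rX.
have dr := lines_span eX Xt rX.
have [|le _] := sign_system_extremal es; first by rewrite dr.
rewrite dr size_map in le.
by rewrite Xt (card_le_eql (card_seq ut)) card_le_II.
Qed.

Section Frame.
Variables (H : sgraph) (w : H -> 'rV[R]_d).
Hypothesis fw : graph_frame w.

Definition frame_lines : set {vspace 'rV[R]_d} := range (fun x => <[w x]>%VS).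

Lemma frame_norm x : dot (w x) (w x) = 3.
Proof. by rewrite fw eqxx. Qed.

Lemma frame_sign (x y : H) : x != y -> is_sign (dot (w x) (w y)).
Proof. by move=> ne; rewrite fw (negPf ne); case: ifP; [left|right]. Qed.

Lemma frame_line_inj : injective (fun x => <[w x]>%VS).
Proof.
move=> x y e; apply/eqP; apply: contraT => ne.
have := frame_sign ne; have ny := frame_norm y.
have := vline_norm3_eq (frame_norm x) ny e; clear e.
by case=> ->; rewrite ?dotNl ny => -[] h; exfalso; lra.
Qed.

Let t := [seq <[w x]>%VS | x <- enum H].

Lemma frame_lines_uniq : uniq t.
Proof. by rewrite (map_inj_uniq frame_line_inj) enum_uniq. Qed.

Lemma frame_linesE : frame_lines = [set` t].
Proof.
apply/seteqP; split=> L /=; first by case=> x _ <-; apply/map_f; rewrite mem_enum.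
by move=> /mapP[x _ ->]; exists x.
Qed.

Lemma frame_lines_card : frame_lines #= `I_#|H|.
Proof.
rewrite frame_linesE cardE -(size_map (fun x => <[w x]>%VS)).
exact: card_seq frame_lines_uniq.
Qed.

Lemma frame_lines_equiangular : equiangular frame_lines (1 / 3).
Proof.
split; first by move=> _ [x _ <-]; exact/is_line_vline/norm3_neq0/frame_norm.
move=> _ _ [x _ <-] [y _ <-] ne; have {}ne : x != y.
  by apply/eqP => e; apply: ne; rewrite e.
rewrite line_angle_norm3 ?frame_norm //; congr (acos (_ / _)).
by case: (frame_sign ne) => ->; rewrite ?normrN normr1.
Qed.

Lemma frame_lines_rank : lines_rank frame_lines (\dim (frame_span w)).
Proof.
exists (frame_span w); split=> //; split.
  by move=> _ [x _ <-]; rewrite -memvE frame_span_mem.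
by move=> W wW; apply: frame_span_sub => x; rewrite memvE; apply: wW; exists x.
Qed.

Lemma frame_gram : gram (fun i => w (enum_val i)) = 3%:M - seidel R H.
Proof.
apply/matrixP => i j; rewrite !mxE fw (inj_eq enum_val_inj).
case: eqVneq => [<-|ne]; first by rewrite adj_irr /=; lra.
by case: adj => /=; lra.
Qed.

(** [3 I - S] is a Gram matrix, hence positive semidefinite, and it is singular
    because the vectors are dependent. *)
Lemma frame_largest_eigenvalue : (\dim (frame_span w) < #|H|)%N ->
  largest_eigenvalue (seidel R H) 3.
Proof.
move=> lt; set S := seidel R H.
have SE : S = 3%:M - gram (fun i => w (enum_val i))
  by rewrite frame_gram opprB addrC subrK.
have comb (v : 'rV_#|H|) j :
    dot (\sum_i v 0 i *: w (enum_val i)) (w (enum_val j)) =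
    (v *m gram (fun i => w (enum_val i))) 0 j.
  by rewrite dot_suml mxE; apply: eq_bigr => i _; rewrite dotZl mxE.
split.
  pose T := [tuple w (enum_val i) | i < #|H|].
  have Ti (i : 'I_#|H|) : T`_i = w (enum_val i) by rewrite -tnth_nth tnth_mktuple.
  have nf : ~~ free T.
    apply: contraL lt => /eqP; rewrite size_tuple => <-; rewrite -leqNgt.
    apply/dimvS/span_subvP => u /tnthP[i ->].
    by rewrite tnth_mktuple frame_span_mem.
  have /existsNP[k /not_implyP[k0 /existsNP[i ki]]] :
      ~ (forall k : 'I_#|H| -> R, \sum_(i < #|H|) k i *: T`_i = 0 ->
           forall i, k i = 0) by move=> /(@freeP _ _ _ T); apply/negP.
  apply/eigenvalueP; exists (\row_i k i); last first.
    by apply/eqP => /rowP/(_ i); rewrite !mxE => h; exact: ki.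
  rewrite SE mulmxBr mul_mx_scalar; apply/rowP => j.
  rewrite mxE [X in _ + X]mxE -comb (_ : \sum_i _ = 0) ?dot0l ?subr0 //.
  by rewrite -[RHS]k0; apply: eq_bigr => i' _; rewrite mxE Ti.
move=> mu /eigenvalueP[v vS v0].
pose z := \sum_i v 0 i *: w (enum_val i).
have dz j : dot z (w (enum_val j)) = (3 - mu) * v 0 j.
  rewrite comb (_ : gram _ = 3%:M - S); last by rewrite SE opprB addrC subrK.
  by rewrite mulmxBr vS mul_mx_scalar !mxE; lra.
have zz : dot z z = (3 - mu) * \sum_j v 0 j ^+ 2.
  rewrite {2}/z dot_sumr mulr_sumr; apply: eq_bigr => j _.
  by rewrite dotZr dz; ring.
have pos : 0 < \sum_j v 0 j ^+ 2.
  rewrite lt_neqAle sumr_ge0 ?andbT; last by move=> j _; exact: sqr_ge0.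
  apply: contra_neq v0 => /esym/eqP; rewrite psumr_eq0; last by move=> j _; exact: sqr_ge0.
  move=> /allP h; apply/rowP => j; rewrite mxE; apply/eqP.
  by have := h j (mem_index_enum j); rewrite sqrf_eq0.
by have := dot_ge0 z; rewrite zz pmulr_lge0 // subr_ge0.
Qed.

Lemma frame_induced : (\dim (frame_span w) < #|H|)%N ->
  induced_by (seidel R H) 3 frame_lines.
Proof.
move=> lt; split; first exact: frame_largest_eigenvalue.
exists (fun i => w (enum_val i)); split; first exact: frame_gram.
apply/seteqP; split=> L [x _ <-].
  by exists (enum_rank x) => //; rewrite enum_rankK.
by exists (enum_val x).
Qed.

End Frame.

End Lines.

Lemma switching_equivalent_refl (G : sgraph) : switching_equivalent G G.
Proof.
exists finset.set0, id; split; first by exists id.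
by move=> x y; rewrite /adj /= /switch_rel !finset.in_set0 eqxx.
Qed.

Section Final.
Context {R : realType}.

Lemma extremal_frame d (s : seq 'rV[R]_d) r : extremal s r ->
  exists w : extremal_graph r -> 'rV[R]_d, graph_frame w /\ forall x, mem_pm s (w x).
Proof.
have edges n (f : 'I_n -> 'rV[R]_d) : (forall i j, i != j -> mem_pm s (f i + f j)) ->
    forall e, mem_pm s (edge_vector f e).
  move=> ff e; have [x [y [xy eE]]] := edge_completeP e.
  by rewrite (edge_vectorE f xy eE) ff.
rewrite /extremal /extremal_graph; case: ifP => _.
  move=> [f [sf ff]]; exists (edge_vector f).
  by split; [exact: edge_vector_frame|exact: edges].
case: ifP => _.
  move=> [f [sf ff fs]]; exists (apex_vector f); split; first exact: apex_vector_frame.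
  by move=> [e|x] /=; [exact: edges|rewrite mem_pmN].
case: ifP => _.
  move=> [f [sf ff]]; exists (edge_vector f).
  by split; [exact: edge_vector_frame|exact: edges].
move=> [h0 [q [h1 hq qq hqs]]]; exists (bip_vector h0 q).
split; first exact: bip_vector_frame.
move=> e; have [c [i eE]] := edge_bipP e; rewrite (bip_vectorE h0 q eE).
by case: ifP => _; have [] := hqs i.
Qed.

Lemma max_lines_gt r : (3 <= r)%N -> (r < max_lines r)%N.
Proof.
by move=> r3; rewrite /max_lines; do 3 (case: eqVneq => [->//|_]); lia.
Qed.

Lemma max_lines_Nstar r : (3 <= r)%N -> is_Nstar (1 / 3 : R) r (max_lines r).
Proof.
move=> r3; split; last by move=> d X; exact: equiangular_card_le.
have [d [w [fw dw]]] := @extremal_graph_frame_exists R r r3.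
exists d, (frame_lines w); split; first exact: frame_lines_equiangular.
  by have := frame_lines_rank w; rewrite dw.
by have := frame_lines_card fw; rewrite card_extremal_graph.
Qed.

Lemma is_Nstar_unique (alpha : R) r n n' : is_Nstar alpha r n ->
  is_Nstar alpha r n' -> n = n'.
Proof.
have le a b : is_Nstar alpha r a -> is_Nstar alpha r b -> (a <= b)%N.
  move=> [[d [X [eX rX Xa]]] _] [_ H].
  by rewrite -card_le_II -(card_le_eql Xa); exact: H.
by move=> A B; apply/eqP; rewrite eqn_leq !le.
Qed.

(** The lines of the model belong to [X], and there are as many of them as in [X]. *)
Lemma maximal_lines_induced r d (X : set {vspace 'rV[R]_d}) : (3 <= r)%N ->
  equiangular X (1 / 3) -> lines_rank X r -> X #= `I_(max_lines r) ->
  induced_by (seidel R (extremal_graph r)) 3 X.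
Proof.
move=> r3 eX rX cX; have [t [ut Xt es]] := equiangular_seq eX rX.
have dr := lines_span eX Xt rX.
have st : size t = max_lines r.
  by apply/card_eq_II; rewrite -(card_eql (card_seq ut)) -Xt.
have [|_ ext] := sign_system_extremal es; first by rewrite dr.
rewrite dr size_map in ext; have [w [fw ws]] := extremal_frame (ext st).
have tX : {in t, forall L, X L} by move=> L Lt; rewrite Xt.
have -> : X = frame_lines w.
  rewrite Xt (frame_linesE w); apply/seteqP.
  suff E : [seq <[w x]>%VS | x <- enum (extremal_graph r)] =i t.
    by split=> L /=; rewrite E.
  apply: (uniq_min_size (frame_lines_uniq fw) _ _).2.
    by move=> _ /mapP[x _ ->]; apply: lines_mem_pm eX tX (ws x).
  by rewrite size_map -cardE card_extremal_graph st.
apply: (frame_induced fw); rewrite card_extremal_graph.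
apply: leq_ltn_trans (max_lines_gt r3); rewrite -[X in (_ <= X)%N]dr.
by apply/dimvS/frame_span_sub => x; exact: mem_pm_span.
Qed.

End Final.

Unset Implicit Arguments.

Theorem corollary3p2 (R : realType) (r : nat) (hr : (3 <= r)%N) :
  is_Nstar (1 / 3 : R) r
    (if r == 5 then 10 else if r == 6 then 16 else if r == 7 then 28
     else 2 * (r - 1))%N /\
  (forall (n d : nat) (X : set {vspace 'rV[R]_d}),
     is_Nstar (1 / 3 : R) r n ->
     equiangular X (1 / 3) -> lines_rank X r -> X #= `I_n ->
     exists G : sgraph,
       switching_equivalent G
         (if r == 5%N then line_graph (complete 5)
          else if r == 6%N then dunion (line_graph (complete 6)) (complete 1)
          else if r == 7%N then line_graph (complete 8)
          else line_graph (complete_bip 2 (r - 1))) /\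
       induced_by (seidel R G) 3 X).
Proof.
split; first exact: max_lines_Nstar.
(* The choice of spanning vectors absorbs switching, so the model graph itself works. *)
move=> n d X nN eX rX cX; exists (extremal_graph r).
split; first exact: switching_equivalent_refl.
apply: maximal_lines_induced => //.
by rewrite -(is_Nstar_unique nN (max_lines_Nstar hr)).
Qed.
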